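(* Let $\epsilon\in(0,1)$ be a given error tolerance. Run inexact IP-PMM (described in the context) on the primal-dual pair (P)–(D) from the starting point described in the context, and let $C,\omega>0$ be constants such that $\mu_0\le C/\epsilon^{\omega}$. Assume that at each iteration the residuals $(\varrho_p^k,\varrho_d^k,\varrho_\mu^k)$ of the inexact Newton system satisfy the residual condition (R), and that the boundedness assumption (B) and the full-rank assumption (F) hold. Then there is a constant $\bar\kappa>0$, independent of $n$ and $m$ and having the step-length property (S) of the context, such that the iterates $\{(x^k,y^k,z^k)\}_{k\ge0}$ generated by inexact IP-PMM satisfy $\mu_k\le\epsilon$ after $$k:=\frac{n^4}{0.01\,\bar\kappa}\Big[(1+\omega)\log(1/\epsilon)+\log C\Big]=O\Big(n^4\log\frac1\epsilon\Big)$$ iterations.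
   Context: **Problem.** $A\in\mathbb R^{m\times n}$, $Q\in\mathbb R^{n\times n}$ diagonal positive semidefinite, $b\in\mathbb R^m$, $c\in\mathbb R^n$. (P): minimize $\frac12x^TQx+c^Tx$ subject to $Ax=b$, $x\ge0$. (D): maximize $b^Ty-\frac12x^TQx$ subject to $A^Ty+z=Qx+c$, $z\ge0$, $y$ free. $\mathbb 1_n$ is the all-ones vector; $\mathrm{diag}(x)$ is the diagonal matrix with diagonal $x$. **Assumption (B).** (P)–(D) has an optimal solution $(x^*,y^*,z^* )$ with $\|x^*\|_\infty,\|y^*\|_\infty,\|z^*\|_\infty\le C^*$, where $C^*\ge0$ is a constant independent of $n,m$. **Assumption (F).** $\mathrm{rank}(A)=m$, and there are constants $C_{\min},C_{\max},C_Q,C_r>0$ independent of $n,m$ such that the smallest singular value of $A$ is $\ge C_{\min}$, the largest singular value of $A$ is $\le C_{\max}$, the largest eigenvalue of $Q$ is $\le C_Q$, and $\|(c,b)\|_\infty\le C_r$. **Parameters.** $0<\sigma_{\min}\le\sigma_{\max}\le0.5$, $C_N>0$, $0<\gamma_{\mathcal A}<1$, $0<\gamma_\mu<1$. **Starting point.** $(x^0,z^0)=\rho(\mathbb 1_n,\mathbb 1_n)$ for some $\rho>0$; $y^0$ arbitrary with $\|y^0\|_\infty=O(1)$; $\zeta^0=x^0$, $\lambda^0=y^0$, $\mu_0=(x^0)^Tz^0/n$; $\bar b,\bar c$ are defined by $Ax^0=b+\bar b$, $-Qx^0+A^Ty^0+z^0=c+\bar c$. **Semi-norm.** For $b'\in\mathbb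 R^m$, $c'\in\mathbb R^n$: $\|(b',c')\|_{\mathcal A}=\min_{x,y,z}\{\|(x,z)\|_2: Ax=b',\ -Qx+A^Ty+z=c'\}$. **Neighborhoods.** For $\mu>0$, $\zeta\in\mathbb R^n$, $\lambda\in\mathbb R^m$, $\mathcal N_\mu(\zeta,\lambda)$ is the set of $(x,y,z)$ with $(x,z)>(0,0)$, $x_iz_i\ge\gamma_\mu\mu$ for all $i$, and such that the vectors $\tilde b,\tilde c$ defined by $Ax+\mu(y-\lambda)=b+\frac{\mu}{\mu_0}(\bar b+\tilde b)$ and $-Qx+A^Ty+z-\mu(x-\zeta)=c+\frac{\mu}{\mu_0}(\bar c+\tilde c)$ satisfy $\|(\tilde b,\tilde c)\|_2\le C_N$ and $\|(\tilde b,\tilde c)\|_{\mathcal A}\le\gamma_{\mathcal A}\rho$. **Inexact Newton system** at iteration $k$, with duality measure $\mu_k=(x^k)^Tz^k/n$ and centering parameter $\sigma_k$: $$-(Q+\mu_kI)\Delta x^k+A^T\Delta y^k+\Delta z^k=-\big[-(c+\tfrac{\sigma_k\mu_k}{\mu_0}\bar c)-Qx^k+A^Ty^k+z^k-\sigma_k\mu_k(x^k-\zeta^k)\big]+\varrho_d^k,$$ $$A\Delta x^k+\mu_k\Delta y^k=-\big[Ax^k+\sigma_k\mu_k(y^k-\lambda^k)-(b+\tfrac{\sigma_k\mu_k}{\mu_0}\bar b)\big]+\varrho_p^k,$$ $$\mathrm{diag}(z^k)\Delta x^k+\mathrm{diag}(x^k)\Delta z^k=-\big[\mathrm{diag}(x^k)\mathrm{diag}(z^k)\mathbb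 1_n-\sigma_k\mu_k\mathbb 1_n\big]+\varrho_\mu^k.$$ **Residual condition (R).** $\varrho_\mu^k=0$, $\|(\varrho_p^k,\varrho_d^k)\|_2\le\frac{\sigma_{\min}}{4\mu_0}C_N\mu_k$, $\|(\varrho_p^k,\varrho_d^k)\|_{\mathcal A}\le\frac{\sigma_{\min}}{4\mu_0}\gamma_{\mathcal A}\rho\,\mu_k$. **Inexact IP-PMM.** For $k=0,1,2,\dots$ (the stopping test is ignored, so an infinite sequence is generated): choose $\sigma_k\in[\sigma_{\min},\sigma_{\max}]$; compute $(\Delta x^k,\Delta y^k,\Delta z^k)$ satisfying the inexact Newton system with residuals satisfying (R); with $\mu_k(\alpha)=(x^k+\alpha\Delta x^k)^T(z^k+\alpha\Delta z^k)/n$, choose the largest $\alpha_k\in(0,1]$ such that $\mu_k(\alpha_k)\le(1-0.01\alpha_k)\mu_k$ and $(x^k,y^k,z^k)+\alpha_k(\Delta x^k,\Delta y^k,\Delta z^k)\in\mathcal N_{\mu_k(\alpha_k)}(\zeta^k,\lambda^k)$; let $(x^{k+1},y^{k+1},z^{k+1})$ be this point and $\mu_{k+1}=(x^{k+1})^Tz^{k+1}/n$. Estimate update: put $\tilde r_p=Ax^{k+1}-b-\frac{\mu_{k+1}}{\mu_0}\bar b$ and $\tilde r_d=-Qx^{k+1}+A^Ty^{k+1}+z^{k+1}-c-\frac{\mu_{k+1}}{\mu_0}\bar c$; if $\|(\tilde r_p,\tilde r_d)\|_2\le C_N\frac{\mu_{k+1}}{\mu_0}$ and $\|(\tilde r_p,\tilde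 r_d)\|_{\mathcal A}\le\gamma_{\mathcal A}\rho\frac{\mu_{k+1}}{\mu_0}$, set $(\zeta^{k+1},\lambda^{k+1})=(x^{k+1},y^{k+1})$; otherwise $(\zeta^{k+1},\lambda^{k+1})=(\zeta^k,\lambda^k)$. **Property (S) of $\bar\kappa$.** There is $\bar\alpha\in(0,1)$ with $\bar\alpha\ge\bar\kappa/n^4$ such that for all $k\ge0$: (i) for all $\alpha\in[0,\bar\alpha]$, $(x^k+\alpha\Delta x^k)^T(z^k+\alpha\Delta z^k)\ge(1-\alpha(1-\frac{\sigma_{\min}}2))(x^k)^Tz^k$; $(x_i^k+\alpha\Delta x_i^k)(z_i^k+\alpha\Delta z_i^k)\ge\frac{\gamma_\mu}{n}(x^k+\alpha\Delta x^k)^T(z^k+\alpha\Delta z^k)$ for all $i$; $(x^k+\alpha\Delta x^k)^T(z^k+\alpha\Delta z^k)\le(1-0.01\alpha)(x^k)^Tz^k$; (ii) if $(x^k,y^k,z^k)\in\mathcal N_{\mu_k}(\zeta^k,\lambda^k)$ then for any $\alpha\in(0,\bar\alpha]$ the point $(x^k,y^k,z^k)+\alpha(\Delta x^k,\Delta y^k,\Delta z^k)$, taken as $(x^{k+1},y^{k+1},z^{k+1})$ with $\mu_{k+1}=(x^{k+1})^Tz^{k+1}/n$ and with $(\zeta^{k+1},\lambda^{k+1})$ from the estimate update, lies in $\mathcal N_{\mu_{k+1}}(\zeta^{k+1},\lambda^{k+1})$. **Constants.** ''Independent of $n$ and $m$'', and the implied constants in $O(\cdot)$, mean: depending only on $\rho$,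 the algorithm parameters, the bound on $\|y^0\|_\infty$, the constants in (B) and (F) and, for the final $O(\cdot)$ in the theorem, also on $C,\omega$ and $\bar\kappa$; not on $n,m,k$. *)

(* Defs.v *)
From HB Require Import structures.
From mathcomp Require Import all_boot all_order all_algebra.
From mathcomp Require Import all_classical all_reals all_analysis.
Set Implicit Arguments.
Unset Strict Implicit.
Unset Printing Implicit Defensive.
Import Order.TTheory GRing.Theory Num.Theory numFieldNormedType.Exports.
Local Open Scope classical_set_scope.
Local Open Scope ring_scope.

(** Vectors of R^n are column vectors ['cV[R]_n].  On them the norm [`|x|] of
    the library is the maximum norm, so it is used for the infinity norm. *)

Definition dotv {R : realType} {n : nat} (u v : 'cV[R]_n) : R :=
  (u^T *m v) ord0 ord0.

Definition norm2 {R : realType} {n : nat} (u : 'cV[R]_n) : R :=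
  Num.sqrt (dotv u u).

Definition nonnegv {R : realType} {n : nat} (u : 'cV[R]_n) : Prop :=
  forall i, 0 <= u i ord0.

Definition posv {R : realType} {n : nat} (u : 'cV[R]_n) : Prop :=
  forall i, 0 < u i ord0.

(** diag(x) *)
Definition diagv {R : realType} {n : nat} (x : 'cV[R]_n) : 'M[R]_n :=
  diag_mx x^T.

Definition psd {R : realType} {n : nat} (M : 'M[R]_n) : Prop :=
  M^T = M /\ forall v : 'cV[R]_n, 0 <= dotv v (M *m v).

(** An m x n matrix has min(m, n) singular values: the square roots of the
    eigenvalues of the smaller of the two Gram matrices. *)
Definition singular_value {R : realType} {m n : nat} (A : 'M[R]_(m, n))
    (s : R) : Prop :=
  0 <= s /\
  if (m <= n)%N then eigenvalue (A *m A^T) (s ^+ 2)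
  else eigenvalue (A^T *m A) (s ^+ 2).

Record qp (R : realType) (m n : nat) := QP {
  qpA : 'M[R]_(m, n);
  qpQ : 'M[R]_n;
  qpb : 'cV[R]_m;
  qpc : 'cV[R]_n }.

Section PrimalDual.
Context {R : realType} {m n : nat} (P : qp R m n).
Let A := qpA P.
Let Q := qpQ P.
Let b := qpb P.
Let c := qpc P.

Definition primal_obj (x : 'cV[R]_n) : R :=
  2^-1 * dotv x (Q *m x) + dotv c x.

Definition primal_feasible (x : 'cV[R]_n) : Prop :=
  A *m x = b /\ nonnegv x.

Definition primal_optimal (x : 'cV[R]_n) : Prop :=
  primal_feasible x /\
  forall x', primal_feasible x' -> primal_obj x <= primal_obj x'.

Definition dual_obj (x : 'cV[R]_n) (y : 'cV[R]_m) : R :=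
  dotv b y - 2^-1 * dotv x (Q *m x).

(** The variables of (D) are (x, y, z); x is not sign constrained there. *)
Definition dual_feasible (x : 'cV[R]_n) (y : 'cV[R]_m) (z : 'cV[R]_n) : Prop :=
  A^T *m y + z = Q *m x + c /\ nonnegv z.

Definition dual_optimal (x : 'cV[R]_n) (y : 'cV[R]_m) (z : 'cV[R]_n) : Prop :=
  dual_feasible x y z /\
  forall x' y' z', dual_feasible x' y' z' -> dual_obj x' y' <= dual_obj x y.

Definition assumption_B (Cstar : R) : Prop :=
  exists x y z, [/\ primal_optimal x, dual_optimal x y z &
    [/\ `|x| <= Cstar, `|y| <= Cstar & `|z| <= Cstar]].

Definition assumption_F (Cmin Cmax CQ Cr : R) : Prop :=
  [/\ \rank A = m,
      forall s, singular_value A s -> Cmin <= s,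
      forall s, singular_value A s -> s <= Cmax,
      forall a, eigenvalue Q a -> a <= CQ
    & `|col_mx c b| <= Cr].

(** The minimum is attained as soon as the constraints are consistent, which
    is always the case when A has full row rank; [inf] is then that minimum. *)
Definition seminormA (b' : 'cV[R]_m) (c' : 'cV[R]_n) : R :=
  inf [set t : R | exists (x : 'cV[R]_n) (y : 'cV[R]_m) (z : 'cV[R]_n),
    [/\ A *m x = b', - (Q *m x) + A^T *m y + z = c'
      & t = norm2 (col_mx x z)]].

End PrimalDual.

Record ippmm_params (R : realType) := IppmmParams {
  sigma_min : R;
  sigma_max : R;
  C_N : R;
  gamma_A : R;
  gamma_mu : R }.

Definition valid_params {R : realType} (p : ippmm_params R) : Prop :=
  [/\ 0 < sigma_min p <= sigma_max p, sigma_max p <= 2^-1, 0 < C_N p,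
      0 < gamma_A p < 1 & 0 < gamma_mu p < 1].

Definition duality_measure {R : realType} {n : nat} (x z : 'cV[R]_n) : R :=
  dotv x z / n%:R.

(** [xs k], [ys k], [zs k], [zetas k], [lams k] are the iterates and the
    proximal estimates (zeta^k, lambda^k); the other sequences are the
    centering parameters, the step lengths, the directions and the residuals
    (rho_p^k, rho_d^k, rho_mu^k) of iteration k. *)
Record trace (R : realType) (m n : nat) := Trace {
  xs : nat -> 'cV[R]_n;
  ys : nat -> 'cV[R]_m;
  zs : nat -> 'cV[R]_n;
  zetas : nat -> 'cV[R]_n;
  lams : nat -> 'cV[R]_m;
  sigmas : nat -> R;
  alphas : nat -> R;
  dxs : nat -> 'cV[R]_n;
  dys : nat -> 'cV[R]_m;
  dzs : nat -> 'cV[R]_n;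
  res_p : nat -> 'cV[R]_m;
  res_d : nat -> 'cV[R]_n;
  res_mu : nat -> 'cV[R]_n }.

Definition mus {R : realType} {m n : nat} (T : trace R m n) (k : nat) : R :=
  duality_measure (xs T k) (zs T k).

Section Algorithm.
Context {R : realType} {m n : nat} (P : qp R m n) (p : ippmm_params R).
Context (rho : R) (y0 : 'cV[R]_m).
Let A := qpA P.
Let Q := qpQ P.
Let b := qpb P.
Let c := qpc P.

Definition x0 : 'cV[R]_n := rho *: const_mx 1.
Definition z0 : 'cV[R]_n := rho *: const_mx 1.
Definition mu0 : R := duality_measure x0 z0.
Definition bbar : 'cV[R]_m := A *m x0 - b.
Definition cbar : 'cV[R]_n := - (Q *m x0) + A^T *m y0 + z0 - c.

Definition neighborhood (mu : R) (zeta : 'cV[R]_n) (lam : 'cV[R]_m)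
    (x : 'cV[R]_n) (y : 'cV[R]_m) (z : 'cV[R]_n) : Prop :=
  [/\ posv x, posv z, forall i, gamma_mu p * mu <= x i ord0 * z i ord0 &
    exists (bt : 'cV[R]_m) (ct : 'cV[R]_n),
    [/\ A *m x + mu *: (y - lam) = b + (mu / mu0) *: (bbar + bt),
        - (Q *m x) + A^T *m y + z - mu *: (x - zeta)
          = c + (mu / mu0) *: (cbar + ct),
        norm2 (col_mx bt ct) <= C_N p
      & seminormA P bt ct <= gamma_A p * rho]].

Definition newton_system (mu sigma : R) (zeta : 'cV[R]_n) (lam : 'cV[R]_m)
    (x : 'cV[R]_n) (y : 'cV[R]_m) (z : 'cV[R]_n)
    (dx : 'cV[R]_n) (dy : 'cV[R]_m) (dz : 'cV[R]_n)
    (rp : 'cV[R]_m) (rd rmu : 'cV[R]_n) : Prop :=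
  [/\ - ((Q + mu%:M) *m dx) + A^T *m dy + dz
        = - (- (c + (sigma * mu / mu0) *: cbar) - Q *m x + A^T *m y + z
             - (sigma * mu) *: (x - zeta)) + rd,
      A *m dx + mu *: dy
        = - (A *m x + (sigma * mu) *: (y - lam)
             - (b + (sigma * mu / mu0) *: bbar)) + rp
    & diagv z *m dx + diagv x *m dz
        = - (diagv x *m diagv z *m const_mx 1 - (sigma * mu) *: const_mx 1)
          + rmu].

Definition residual_condition (mu : R) (rp : 'cV[R]_m) (rd rmu : 'cV[R]_n) :
    Prop :=
  [/\ rmu = 0,
      norm2 (col_mx rp rd) <= sigma_min p / (4 * mu0) * C_N p * mu
    & seminormA P rp rd <= sigma_min p / (4 * mu0) * gamma_A p * rho * mu].

Definition estimate_update (x : 'cV[R]_n) (y : 'cV[R]_m) (z : 'cV[R]_n)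
    (zeta : 'cV[R]_n) (lam : 'cV[R]_m) : 'cV[R]_n * 'cV[R]_m :=
  let mu := duality_measure x z in
  let rp := A *m x - b - (mu / mu0) *: bbar in
  let rd := - (Q *m x) + A^T *m y + z - c - (mu / mu0) *: cbar in
  if (norm2 (col_mx rp rd) <= C_N p * (mu / mu0)) &&
     (seminormA P rp rd <= gamma_A p * rho * (mu / mu0))
  then (x, y) else (zeta, lam).

Section Run.
Context (T : trace R m n).

Definition trial_x (k : nat) (alpha : R) : 'cV[R]_n :=
  xs T k + alpha *: dxs T k.
Definition trial_y (k : nat) (alpha : R) : 'cV[R]_m :=
  ys T k + alpha *: dys T k.
Definition trial_z (k : nat) (alpha : R) : 'cV[R]_n :=
  zs T k + alpha *: dzs T k.
Definition trial_mu (k : nat) (alpha : R) : R :=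
  duality_measure (trial_x k alpha) (trial_z k alpha).

Definition admissible_step (k : nat) (alpha : R) : Prop :=
  [/\ 0 < alpha <= 1,
      trial_mu k alpha <= (1 - 100^-1 * alpha) * mus T k
    & neighborhood (trial_mu k alpha) (zetas T k) (lams T k)
        (trial_x k alpha) (trial_y k alpha) (trial_z k alpha)].

Definition ippmm_start : Prop :=
  [/\ xs T 0%N = x0, ys T 0%N = y0, zs T 0%N = z0,
      zetas T 0%N = x0 & lams T 0%N = y0].

Definition ippmm_iteration (k : nat) : Prop :=
  [/\ sigma_min p <= sigmas T k <= sigma_max p,
      newton_system (mus T k) (sigmas T k) (zetas T k) (lams T k)
        (xs T k) (ys T k) (zs T k) (dxs T k) (dys T k) (dzs T k)
        (res_p T k) (res_d T k) (res_mu T k),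
      admissible_step k (alphas T k) /\
        (forall alpha, admissible_step k alpha -> alpha <= alphas T k),
      [/\ xs T k.+1 = trial_x k (alphas T k),
          ys T k.+1 = trial_y k (alphas T k)
        & zs T k.+1 = trial_z k (alphas T k)]
    & (zetas T k.+1, lams T k.+1)
        = estimate_update (xs T k.+1) (ys T k.+1) (zs T k.+1)
            (zetas T k) (lams T k)].

(** The requirement that the residuals be small is not included here; see
    [residual_condition]. *)
Definition ippmm_run : Prop :=
  ippmm_start /\ forall k, ippmm_iteration k.

Definition residuals_controlled : Prop :=
  forall k, residual_condition (mus T k) (res_p T k) (res_d T k) (res_mu T k).

Definition step_length_property (kappa : R) : Prop :=
  exists alphabar : R,
  [/\ 0 < alphabar < 1, kappa / n%:R ^+ 4 <= alphabar &
    forall k,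
    (forall alpha, 0 <= alpha <= alphabar ->
      [/\ (1 - alpha * (1 - sigma_min p / 2)) * dotv (xs T k) (zs T k)
            <= dotv (trial_x k alpha) (trial_z k alpha),
          forall i, gamma_mu p / n%:R * dotv (trial_x k alpha) (trial_z k alpha)
            <= trial_x k alpha i ord0 * trial_z k alpha i ord0
        & dotv (trial_x k alpha) (trial_z k alpha)
            <= (1 - 100^-1 * alpha) * dotv (xs T k) (zs T k)])
    /\
    (neighborhood (mus T k) (zetas T k) (lams T k) (xs T k) (ys T k) (zs T k) ->
     forall alpha, 0 < alpha <= alphabar ->
       let x' := trial_x k alpha in
       let y' := trial_y k alpha in
       let z' := trial_z k alpha in
       let est := estimate_update x' y' z' (zetas T k) (lams T k) in
       neighborhood (duality_measure x' z') est.1 est.2 x' y' z')].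

End Run.
End Algorithm.

Definition iteration_count {R : realType} (n : nat) (kappa C omega eps : R) :
    R :=
  n%:R ^+ 4 / (100^-1 * kappa) * ((1 + omega) * ln (1 / eps) + ln C).

(* Main.v *)
(** Subtracting from an iterate (x, y, z) the convex combination, with weight
    theta = mu / mu0, of a shifted starting point and of a complementary optimal
    triple leaves a difference (d, e, f) with
      d.f = d.Qd + mu d.(x - zeta) + mu e.(y - lam).
    Right after an estimate update the last two terms vanish, which bounds
    |x|_1 + |z|_1 by a multiple of n, hence the estimates (zeta, lam) as well; in
    general the two terms are quadratic in the distance to the reference point,
    which bounds x, y, z, x - zeta and y - lam by multiples of n in the 2-norm.

    The Newton direction is treated in the same way: after a shift of entries
    O(mu), the remaining part (d, e, f) satisfies
      2 d.f >= mu (|d|^2 + |e|^2) - O(n^2 mu),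
    and the scaled complementarity equation then yields
    sum_i |dx_i dz_i| = O(n^2 mu) and |dx|, |dy| = O(n).

    Along a step alpha the residuals shrink by the factor 1 - alpha, up to the
    Newton residuals and a term alpha^2 O(n^3 mu), whereas mu shrinks at most by
    1 - alpha (1 - sigma_min / 2), so steps of order n^-4 (even n^-3) are
    admissible, and each iteration multiplies mu by at most 1 - 0.01 kappa / n^4. *)

Require Import Defs.
From mathcomp Require Import all_boot all_order all_algebra.
From mathcomp Require Import all_classical all_reals all_analysis.
From mathcomp Require Import ring lra.
Set Implicit Arguments.
Unset Strict Implicit.
Unset Printing Implicit Defensive.
Import Order.TTheory GRing.Theory Num.Theory numFieldNormedType.Exports.
Local Open Scope ring_scope.

(** Assumption (B) gives optimality in (P) and in (D) separately, while the argument needs x*.z* =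
    0; this is why strong duality, and with it Farkas' lemma, is proved first. The semi-norm
    condition with gamma_A < 1 has one purpose: it writes the perturbation (bt, ct) as the image of
    a shift (xh, yh, zh) with |(xh, zh)| strictly below rho, so that the shifted starting point
    stays strictly positive. The main obstacle is that zeta and lam are iterates of an unknown
    earlier iteration: a bound on x in terms of zeta could grow at every update. The bound used at
    an update therefore does not mention the old estimates, and it is carried as an invariant until
    the next update. Q may vanish, so the only curvature available in the Newton system is the
    proximal one, mu I. It suffices because the terms that it has to dominate carry a factor mu as
    well; mu cancels, and the directions stay O(n) however small mu is. *)

(** * Inner product and Euclidean norm of column vectors *)

Section Vectors.
Context {R : realType}.
Implicit Types (n m : nat) (a : R).

Lemma dotvE n (u v : 'cV[R]_n) : dotv u v = \sum_i u i ord0 * v i ord0.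
Proof. by rewrite /dotv mxE; apply: eq_bigr => i _; rewrite mxE. Qed.

Lemma dotvC n (u v : 'cV[R]_n) : dotv u v = dotv v u.
Proof. by rewrite !dotvE; apply: eq_bigr => i _; rewrite mulrC. Qed.

Lemma dotvDr n (u v w : 'cV[R]_n) : dotv u (v + w) = dotv u v + dotv u w.
Proof. by rewrite /dotv mulmxDr mxE. Qed.

Lemma dotvNr n (u v : 'cV[R]_n) : dotv u (- v) = - dotv u v.
Proof. by rewrite /dotv mulmxN mxE. Qed.

Lemma dotvZr n a (u v : 'cV[R]_n) : dotv u (a *: v) = a * dotv u v.
Proof. by rewrite /dotv -scalemxAr mxE. Qed.

Lemma dotvDl n (u v w : 'cV[R]_n) : dotv (u + v) w = dotv u w + dotv v w.
Proof. by rewrite dotvC dotvDr !(dotvC w). Qed.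

Lemma dotvNl n (u v : 'cV[R]_n) : dotv (- u) v = - dotv u v.
Proof. by rewrite dotvC dotvNr (dotvC v). Qed.

Lemma dotvZl n a (u v : 'cV[R]_n) : dotv (a *: u) v = a * dotv u v.
Proof. by rewrite dotvC dotvZr (dotvC v). Qed.

Lemma dotv0r n (u : 'cV[R]_n) : dotv u 0 = 0.
Proof. by rewrite /dotv mulmx0 mxE. Qed.

Definition dotv_bilin := (@dotvDl, @dotvDr, @dotvNl, @dotvNr, @dotvZl, @dotvZr).

Lemma dotv_mulmx n m (M : 'M[R]_(n, m)) (u : 'cV_n) (v : 'cV_m) :
  dotv u (M *m v) = dotv (M^T *m u) v.
Proof. by rewrite /dotv trmx_mul trmxK mulmxA. Qed.

Lemma dotv_ge0 n (u : 'cV[R]_n) : 0 <= dotv u u.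
Proof. by rewrite dotvE; apply: sumr_ge0 => i _; rewrite -expr2 sqr_ge0. Qed.

Lemma dotv_eq0 n (u : 'cV[R]_n) : dotv u u = 0 -> u = 0.
Proof.
rewrite dotvE => /eqP; rewrite psumr_eq0; last first.
  by move=> i _; rewrite -expr2 sqr_ge0.
move=> /allP h; apply/colP => i; rewrite mxE; apply/eqP.
by have := h i (mem_index_enum _); rewrite -expr2 sqrf_eq0.
Qed.

Lemma dotv_nonneg n (u v : 'cV[R]_n) :
  (forall i, 0 <= u i ord0) -> (forall i, 0 <= v i ord0) -> 0 <= dotv u v.
Proof. by move=> hu hv; rewrite dotvE; apply: sumr_ge0 => i _; apply: mulr_ge0. Qed.

Lemma norm2_ge0 n (u : 'cV[R]_n) : 0 <= norm2 u.
Proof. exact: sqrtr_ge0. Qed.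

Lemma sqr_norm2 n (u : 'cV[R]_n) : norm2 u ^+ 2 = dotv u u.
Proof. by rewrite sqr_sqrtr // dotv_ge0. Qed.

Lemma norm2_le n (u : 'cV[R]_n) a : 0 <= a -> dotv u u <= a ^+ 2 -> norm2 u <= a.
Proof. by move=> a0 h; rewrite -(ger0_norm a0) -sqrtr_sqr ler_wsqrtr. Qed.

Lemma dotv_le_sqr n (u : 'cV[R]_n) a : norm2 u <= a -> dotv u u <= a ^+ 2.
Proof.
by move=> h; rewrite -sqr_norm2 lerXn2r // nnegrE ?norm2_ge0 // (le_trans (norm2_ge0 _) h).
Qed.

Lemma norm2_0 n : norm2 (0 : 'cV[R]_n) = 0.
Proof. by rewrite /norm2 dotv0r sqrtr0. Qed.

Lemma norm2Z n a (u : 'cV[R]_n) : norm2 (a *: u) = `|a| * norm2 u.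
Proof.
by rewrite /norm2 dotvZl dotvZr mulrA -expr2 sqrtrM ?sqr_ge0 // sqrtr_sqr.
Qed.

Lemma norm2N n (u : 'cV[R]_n) : norm2 (- u) = norm2 u.
Proof. by rewrite -scaleN1r norm2Z normrN1 mul1r. Qed.

Lemma sqr_dotv_le n (u v : 'cV[R]_n) : dotv u v ^+ 2 <= dotv u u * dotv v v.
Proof.
have [u0|u0] := eqVneq (dotv u u) 0.
  by rewrite (dotv_eq0 u0) dotvC !dotv0r expr0n mul0r.
have up : 0 < dotv u u by rewrite lt_neqAle eq_sym u0 dotv_ge0.
have := dotv_ge0 (dotv u u *: v - dotv u v *: u).
rewrite !dotv_bilin (dotvC v u) => h.
have : 0 <= dotv u u * (dotv u u * dotv v v - dotv u v ^+ 2) by lra.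
by rewrite pmulr_rge0 // subr_ge0.
Qed.

Lemma dotv_le_norm2 n (u v : 'cV[R]_n) : `|dotv u v| <= norm2 u * norm2 v.
Proof.
rewrite -sqrtr_sqr /norm2 -sqrtrM ?dotv_ge0 //.
by rewrite ler_wsqrtr // sqr_dotv_le.
Qed.

Lemma norm2D n (u v : 'cV[R]_n) : norm2 (u + v) <= norm2 u + norm2 v.
Proof.
apply: norm2_le; first by rewrite addr_ge0 ?norm2_ge0.
have := ler_norml (dotv u v) (norm2 u * norm2 v).
rewrite dotv_le_norm2 => /esym/andP[_ h].
have := sqr_norm2 u; have := sqr_norm2 v.
by rewrite !dotv_bilin (dotvC v u); nra.
Qed.

Lemma norm2B n (u v : 'cV[R]_n) : norm2 (u - v) <= norm2 u + norm2 v.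
Proof. by rewrite -(norm2N v) norm2D. Qed.

Lemma dotv_col_mx n m (u u' : 'cV[R]_n) (v v' : 'cV[R]_m) :
  dotv (col_mx u v) (col_mx u' v') = dotv u u' + dotv v v'.
Proof. by rewrite /dotv tr_col_mx mul_row_col mxE. Qed.

Lemma norm2_col_mxl n m (u : 'cV[R]_n) (v : 'cV[R]_m) : norm2 u <= norm2 (col_mx u v).
Proof. by rewrite /norm2 dotv_col_mx ler_wsqrtr // lerDl dotv_ge0. Qed.

Lemma norm2_col_mxr n m (u : 'cV[R]_n) (v : 'cV[R]_m) : norm2 v <= norm2 (col_mx u v).
Proof. by rewrite /norm2 dotv_col_mx ler_wsqrtr // lerDr dotv_ge0. Qed.

Lemma norm2_col_mx n m (u : 'cV[R]_n) (v : 'cV[R]_m) :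
  norm2 (col_mx u v) <= norm2 u + norm2 v.
Proof.
apply: norm2_le; first by rewrite addr_ge0 ?norm2_ge0.
rewrite dotv_col_mx -!sqr_norm2.
by have := norm2_ge0 u; have := norm2_ge0 v; nra.
Qed.

Lemma abs_le_norm2 n (u : 'cV[R]_n) i : `|u i ord0| <= norm2 u.
Proof.
rewrite -sqrtr_sqr ler_wsqrtr // dotvE (bigD1 i) //= -expr2 lerDl.
by apply: sumr_ge0 => j _; rewrite -expr2 sqr_ge0.
Qed.

(** The sharp factor sqrt n is weakened to n, so that all later bounds are polynomials in n. The
    empty vector is treated apart because then nothing forces [a] to be nonnegative. *)
Lemma norm2_le_entries n (u : 'cV[R]_n) a :
  (forall i, `|u i ord0| <= a) -> norm2 u <= a * n%:R.
Proof.
case: n u => [|n] u h.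
  by rewrite (_ : u = 0) ?norm2_0 ?mulr0 //; apply/colP; case.
have a0 : 0 <= a by apply: le_trans (h ord0).
apply: norm2_le; first by rewrite mulr_ge0.
rewrite dotvE; apply: (@le_trans _ _ (\sum_(i < n.+1) a ^+ 2)).
  apply: ler_sum => i _; rewrite -expr2 -real_normK ?num_real //.
  by rewrite lerXn2r // nnegrE.
rewrite sumr_const card_ord exprMn -[leLHS]mulr_natr ler_wpM2l ?sqr_ge0 //.
by rewrite expr2 -natrM ler_nat leq_pmull.
Qed.

Lemma abs_le_mx_norm n (u : 'cV[R]_n) i : `|u i ord0| <= `|u|.
Proof.
rewrite [leRHS]mx_normrE.
exact: (le_bigmax _ (fun ij : 'I_n * 'I_1 => `|u ij.1 ij.2|) (i, ord0)).
Qed.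

Lemma norm2_le_sum n (u : 'cV[R]_n) :
  (forall i, 0 <= u i ord0) -> norm2 u <= \sum_i u i ord0.
Proof.
move=> h; apply: norm2_le; first exact: sumr_ge0.
rewrite dotvE expr2 mulr_suml; apply: ler_sum => i _.
by rewrite ler_wpM2l // (bigD1 i) //= lerDl sumr_ge0.
Qed.

End Vectors.

(** * Strong duality *)

Section Farkas.
Context {R : realType}.

Lemma nonnegv_col_mx m n (u : 'cV[R]_m) (v : 'cV[R]_n) :
  nonnegv u -> nonnegv v -> nonnegv (col_mx u v).
Proof.
by move=> hu hv i; have [j ->|j ->] := split_ordP i; rewrite ?col_mxEu ?col_mxEd.
Qed.

(* Bartl's induction: if the inequalities of M' alone do not imply 0 <= g.d, a
   violating xh has a.xh < 0, and projecting along xh onto the kernel of the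
   row a removes that row. *)
Lemma farkas N n (M : 'M[R]_(N, n)) (g : 'cV[R]_n) :
  (forall d : 'cV[R]_n, nonnegv (M *m d) -> 0 <= dotv g d) ->
  exists2 l : 'cV[R]_N, nonnegv l & g = M^T *m l.
Proof.
elim: N M g => [|N IH] M g h.
  exists 0; first by move=> i; rewrite mxE.
  rewrite mulmx0; apply: dotv_eq0; apply/eqP.
  rewrite eq_le dotv_ge0 andbT -oppr_ge0 -dotvNr; apply: h.
  by case.
pose a : 'M[R]_(1, n) := usubmx (M : 'M[R]_(1 + N, n)).
pose M' : 'M[R]_(N, n) := dsubmx (M : 'M[R]_(1 + N, n)).
have hMd (d : 'cV[R]_n) : M *m d = col_mx (a *m d) (M' *m d).
  by have := mul_col_mx a M' d; rewrite vsubmxK.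
have hMt (u : 'cV[R]_1) l : M^T *m col_mx u l = a^T *m u + M'^T *m l.
  by have := mul_row_col a^T M'^T u l; rewrite -tr_col_mx vsubmxK.
have hM (d : 'cV[R]_n) : 0 <= (a *m d) ord0 ord0 -> nonnegv (M' *m d) ->
    0 <= dotv g d.
  move=> ha hd; apply: h; rewrite hMd.
  have ha' : nonnegv (a *m d) by move=> i; rewrite ord1.
  exact (nonnegv_col_mx ha' hd).
have [hM'|] := pselect (forall d : 'cV[R]_n, nonnegv (M' *m d) -> 0 <= dotv g d).
  have [l l0 ->] := IH _ _ hM'.
  exists (col_mx 0 l : 'cV[R]_(1 + N)).
    have h0 : nonnegv (0 : 'cV[R]_1) by move=> i; rewrite mxE.
    exact (nonnegv_col_mx h0 l0).
  by rewrite hMt mulmx0 add0r.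
move=> /existsNP [xh /not_implyP [hxh /negP]]; rewrite -ltNge => gxh.
pose s := (a *m xh) ord0 ord0.
have s0 : s < 0.
  by rewrite ltNge; apply/negP => s0; have := hM _ s0 hxh; rewrite leNgt gxh.
pose M2 := M' - s^-1 *: (M' *m xh *m a).
pose g2 := g - (dotv g xh / s) *: a^T.
have aE (d : 'cV[R]_n) : a *m d = ((a *m d) ord0 ord0)%:M.
  by rewrite [LHS]mx11_scalar.
have hd2 d : nonnegv (M2 *m d) -> 0 <= dotv g2 d.
  move=> hd.
  pose t := (a *m d) ord0 ord0 / s.
  have e1 : a *m (d - t *: xh) = 0.
    rewrite mulmxBr -scalemxAr (aE d) (aE xh) -/s.
    by rewrite scale_scalar_mx /t mulfVK ?subrr ?lt_eqF.
  have := hM (d - t *: xh).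
  rewrite e1 mxE => /(_ (lexx _)); have -> : M' *m (d - t *: xh) = M2 *m d.
    rewrite /M2 mulmxBl mulmxBr -!scalemxAl -scalemxAr; congr (_ - _).
    rewrite -(mulmxA (M' *m xh)) (aE d) mul_mx_scalar scalerA /t; congr (_ *: _).
    by rewrite mulrC.
  move=> /(_ hd); rewrite /g2 !dotv_bilin.
  suff -> : dotv g xh / s * dotv a^T d = t * dotv g xh by [].
  by rewrite /dotv trmxK /t mulrAC -mulrA mulrC.
have [l l0 gE] := IH _ _ hd2.
(* The multiplier of the row a restores what the projection removed; it is a quotient of a
   nonpositive number by the negative [s]. *)
pose l1 : R := dotv g xh / s - dotv (M' *m xh) l / s.
exists (col_mx (const_mx l1) l : 'cV[R]_(1 + N)).
  suff h1 : nonnegv (const_mx l1 : 'cV[R]_1) by exact (nonnegv_col_mx h1 l0).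
  move=> i; rewrite mxE /l1 -mulrBl -mulrNN -invrN; apply: mulr_ge0.
    by rewrite oppr_ge0 subr_le0; apply: le_trans (ltW gxh) _; apply: dotv_nonneg.
  by rewrite invr_ge0 oppr_ge0 ltW.
rewrite hMt.
have -> : g = g2 + (dotv g xh / s) *: a^T by rewrite subrK.
have -> : a^T *m const_mx l1 = l1 *: a^T.
  by rewrite [const_mx _]mx11_scalar mxE mul_mx_scalar.
rewrite gE /M2 raddfB /= linearZ /= trmx_mul mulmxBl -scalemxAl -mulmxA.
have -> : (M' *m xh)^T *m l = (dotv (M' *m xh) l)%:M by rewrite [LHS]mx11_scalar.
rewrite mul_mx_scalar /l1 scalerBl scalerA (mulrC s^-1).
by rewrite -addrA addrC; congr (_ + _); rewrite addrC.
Qed.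

(** No feasible direction d at x can have g.d < 0, g being the gradient, since a short step along d
    would lower the objective. Farkas' lemma turns this into multipliers for A d >= 0, - A d >= 0
    and d_i >= 0 on the active coordinates. *)
Lemma KKT m n (P : qp R m n) (x : 'cV[R]_n) :
  psd (qpQ P) -> primal_optimal P x ->
  exists y z, dual_feasible P x y z /\ dotv x z = 0.
Proof.
case: P => A Q b c /= [Qs Q0] [[/= Axb x0] xmin].
pose g := Q *m x + c.
(* Rows of inactive coordinates are zero, so z = E l3 vanishes wherever x does not: complementarity
   holds by construction. *)
pose E : 'M[R]_n := diag_mx (\row_i (x i ord0 == 0)%:R).
have Ev (v : 'cV[R]_n) i : (E *m v) i ord0 = (x i ord0 == 0)%:R * v i ord0.
  by rewrite mul_diag_mx !mxE.
have [|l l0 gE] := @farkas _ _ (col_mx (col_mx A (- A)) E) g.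
  move=> d; rewrite !mul_col_mx mulNmx => hd.
  have Ad i : 0 <= (A *m d) i ord0.
    by have := hd (lshift _ (lshift _ i)); rewrite !col_mxEu.
  have NAd i : 0 <= (- (A *m d)) i ord0.
    by have := hd (lshift _ (rshift _ i)); rewrite col_mxEu col_mxEd.
  have Ed i : 0 <= (E *m d) i ord0 by have := hd (rshift _ i); rewrite col_mxEd.
  have {NAd} Ad0 : A *m d = 0.
    apply/colP => i; apply/eqP; rewrite [X in _ == X]mxE eq_le Ad andbT.
    by have := NAd i; rewrite mxE oppr_ge0.
  (* For t <= (1 + S)^-1 every positive x_j dominates t |d_j|. Where x_j = 0 the quotient is 0 by
     convention, and [Ed] gives d_j >= 0. *)
  pose S := \sum_j `|d j ord0| / x j ord0.
  have S0 : 0 <= S by apply: sumr_ge0 => j _; rewrite divr_ge0.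
  have feas t : 0 <= t <= (1 + S)^-1 -> primal_feasible (QP A Q b c) (x + t *: d).
    move=> /andP[t0 t1]; split=> /=; first by rewrite mulmxDr -scalemxAr Ad0 scaler0 addr0.
    move=> i; rewrite !mxE.
    have := x0 i; rewrite le_eqVlt => /predU1P[xi|xi].
      rewrite -xi add0r mulr_ge0 //; have := Ed i.
      by rewrite Ev -xi eqxx mul1r.
    have h1 : `|d i ord0| / x i ord0 <= S.
      by rewrite /S (bigD1 i) //= lerDl sumr_ge0 // => j _; rewrite divr_ge0.
    have h2 : t * (`|d i ord0| / x i ord0) <= 1.
      apply: le_trans (_ : (1 + S)^-1 * (1 + S) <= 1); last by rewrite mulVf // gt_eqF // ltr_wpDr.
      by apply: ler_pM => //; [rewrite divr_ge0 | rewrite (le_trans h1) // lerDr].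
    rewrite mulrA ler_pdivrMr // mul1r in h2.
    have := lerNnormlW (lexx `|t * d i ord0|).
    by rewrite normrM (ger0_norm t0); lra.
  rewrite leNgt; apply/negP => gd.
  pose q := dotv d (Q *m d).
  have q0 : 0 <= q by exact: Q0.
  have q1 : 0 < q + 1 by rewrite ltr_wpDl.
  have S1 : 0 < (1 + S)^-1 by rewrite invr_gt0 ltr_wpDr.
  (* The first bound keeps x + t d feasible; the second makes t q / 2 smaller than - g.d, a strict
     decrease. The denominator is q + 1 because q may be 0. *)
  pose t := Num.min (1 + S)^-1 (- dotv g d / (q + 1)).
  have t0 : 0 < t by rewrite lt_min S1 divr_gt0 // oppr_gt0.
  have tS : t <= (1 + S)^-1 by rewrite ge_min lexx.
  have tg : t * (q + 1) <= - dotv g d by rewrite -ler_pdivlMr // ge_min lexx orbT.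
  have := xmin _ (feas t _); rewrite (ltW t0) tS => /(_ isT).
  rewrite /primal_obj /= !mulmxDr -!scalemxAr !dotv_bilin -/q.
  have -> : dotv d (Q *m x) = dotv (Q *m x) d by rewrite dotvC.
  have -> : dotv x (Q *m d) = dotv (Q *m x) d by rewrite dotv_mulmx Qs.
  move: gd tg; rewrite /g dotvDl.
  move: (dotv (Q *m x) d) (dotv c d) => u v gd tg h.
  have : 0 <= t * (u + v + 2^-1 * (t * q)) by lra.
  rewrite pmulr_rge0 // leNgt => /negP; apply; nra.
pose l1 := usubmx (usubmx l); pose l2 := dsubmx (usubmx l); pose l3 := dsubmx l.
have lE : l = col_mx (col_mx l1 l2) l3 by rewrite !vsubmxK.
have l30 : nonnegv l3 by move=> i; rewrite mxE.
exists (l1 - l2), (E *m l3); split; first split => /=.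
- rewrite -/g gE lE !tr_col_mx !mul_row_col linearN /= mulNmx mulmxBr.
  by rewrite /E tr_diag_mx.
- by move=> i; rewrite Ev mulr_ge0.
- rewrite dotvE big1 // => i _; rewrite Ev.
  by case: eqP => [->|]; rewrite ?mul0r // mulr0.
Qed.

(** Strong duality: a multiplier of [x] given by KKT is dual feasible with dual
    value equal to the primal one, so the dual optimal [y] closes the gap. *)
Lemma complementarity m n (P : qp R m n) (x : 'cV[R]_n) (y : 'cV[R]_m) (z : 'cV[R]_n) :
  psd (qpQ P) -> primal_optimal P x -> dual_optimal P x y z -> dotv x z = 0.
Proof.
move=> Qpsd xopt [[yz z0] ymax].
have [y' [z' [yz' xz']]] := KKT Qpsd xopt.
have [[Axb x0] _] := xopt.
have := ymax _ _ _ yz'; rewrite /dual_obj lerD2r -Axb ![dotv (_ *m _) _]dotvC !dotv_mulmx.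
rewrite !(dotvC _ x) => h.
apply/eqP; rewrite eq_le dotv_nonneg // andbT.
have := congr1 (dotv x) yz; have := congr1 (dotv x) yz'.1.
by rewrite !dotvDr xz'; lra.
Qed.

End Farkas.

(** * Singular values and the Rayleigh quotient *)

Section Spectral.
Context {R : realType}.

(** Only the finiteness of K matters: it serves the infimum of the Rayleigh quotient and never
    enters the constants of the theorem, so its dependence on m is harmless. *)
Lemma norm2_mulmx_bounded m n (W : 'M[R]_(m, n)) :
  exists2 K : R, 0 <= K & forall v, norm2 (W *m v) <= K * norm2 v.
Proof.
pose S := \sum_i \sum_j `|W i j|.
have S0 : 0 <= S by apply: sumr_ge0 => i _; apply: sumr_ge0.
exists (S * m%:R) => [|v]; first by rewrite mulr_ge0.
rewrite mulrAC; apply: norm2_le_entries => i; rewrite mxE.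
apply: le_trans (ler_norm_sum _ _ _) _.
apply: (@le_trans _ _ ((\sum_j `|W i j|) * norm2 v)).
  rewrite mulr_suml; apply: ler_sum => j _.
  by rewrite normrM ler_wpM2l // abs_le_norm2.
rewrite ler_wpM2r ?norm2_ge0 // /S (bigD1 i) //= lerDl.
by apply: sumr_ge0 => k _; apply: sumr_ge0.
Qed.

Lemma dotv_mulmx_bounded n (W : 'M[R]_n) :
  exists2 K : R, 0 < K & forall v, `|dotv v (W *m v)| <= K * dotv v v.
Proof.
have [K K0 hK] := norm2_mulmx_bounded W.
exists (K + 1) => [|v]; first by rewrite ltr_wpDl.
apply: le_trans (dotv_le_norm2 _ _) _.
have := hK v; have := norm2_ge0 v; rewrite -sqr_norm2; nra.
Qed.

(* The infimum l of the Rayleigh quotient is an eigenvalue: otherwise N = M - l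
   is invertible, and nonnegativity of the form N at v - N^-1 v / K, where K
   bounds N^-1, gives v.Nv >= v.v / K, so the infimum would be larger. *)
Lemma le_eigenvalue_dotv n (M : 'M[R]_n) c :
  M^T = M -> (forall a, eigenvalue M a -> c <= a) ->
  forall v : 'cV[R]_n, c * dotv v v <= dotv v (M *m v).
Proof.
move=> Msym hc v; rewrite leNgt; apply/negP => hv.
have pos (w : 'cV[R]_n) : w != 0 -> 0 < dotv w w.
  by move=> w0; rewrite lt_neqAle dotv_ge0 andbT eq_sym; apply: contra_neq w0; apply: dotv_eq0.
have v0 : 0 < dotv v v.
  apply: pos; apply: contraTneq hv => ->.
  by rewrite mulmx0 !dotv0r mulr0 ltxx.
pose E := [set t : R | exists2 w : 'cV[R]_n, 0 < dotv w w &
  t = dotv w (M *m w) / dotv w w]%classic.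
have Ev : E (dotv v (M *m v) / dotv v v) by exists v.
have [K K0 hK] := dotv_mulmx_bounded M.
have lbE : lbound E (- K).
  move=> _ [w w0 ->]; rewrite ler_pdivlMr // mulNr.
  by apply: lerNnormlW; apply: hK.
pose l := inf E.
have hl (w : 'cV[R]_n) : l * dotv w w <= dotv w (M *m w).
  have [->|w0] := eqVneq w 0; first by rewrite mulmx0 !dotv0r mulr0.
  rewrite -ler_pdivlMr ?pos //; apply: ge_inf; first by exists (- K).
  by exists w; rewrite // pos.
have lc : l < c.
  apply: (@le_lt_trans _ _ (dotv v (M *m v) / dotv v v)).
    by apply: ge_inf => //; exists (- K).
  by rewrite ltr_pdivrMr.
have : eigenvalue M l.
  rewrite /eigenvalue /eigenspace kermx_eq0 row_free_unit; apply/negP => Nu.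
  pose N := M - l%:M; rewrite -/N in Nu.
  have Nsym : N^T = N by rewrite /N raddfB /= Msym tr_scalar_mx.
  have NE (w : 'cV[R]_n) : N *m w = M *m w - l *: w by rewrite mulmxBl mul_scalar_mx.
  have N0 (w : 'cV[R]_n) : 0 <= dotv w (N *m w).
    by rewrite NE !dotv_bilin subr_ge0.
  have [J J0 hJ] := dotv_mulmx_bounded (invmx N).
  have lb2 : lbound E (l + J^-1).
    move=> _ [w w0 ->]; rewrite ler_pdivlMr // mulrDl.
    pose u := invmx N *m w.
    have Nu_w : N *m u = w by rewrite /u mulKVmx.
    have := N0 (w - J^-1 *: u).
    rewrite mulmxBr -scalemxAr Nu_w !dotv_bilin.
    have -> : dotv u (N *m w) = dotv w w by rewrite dotv_mulmx Nsym Nu_w.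
    have hu : dotv u w <= J * dotv w w.
      by rewrite dotvC; apply: le_trans (ler_norm _) (hJ w).
    have : J^-1 * (J^-1 * dotv u w) <= J^-1 * dotv w w.
      by apply: ler_wpM2l; [rewrite invr_ge0 ltW | rewrite ler_pdivrMl].
    by rewrite NE !dotv_bilin; lra.
  have : l + J^-1 <= l by apply: lb_le_inf => //; exists (dotv v (M *m v) / dotv v v).
  by rewrite leNgt ltrDl invr_gt0 J0.
by move=> /hc; rewrite leNgt lc.
Qed.

Lemma singular_value_sqrt m n (A : 'M[R]_(m, n)) a :
  (m <= n)%N -> eigenvalue (A *m A^T) a ->
  0 <= a /\ singular_value A (Num.sqrt a).
Proof.
move=> mn ha.
suff a0 : 0 <= a by split=> //; split; rewrite ?sqrtr_ge0 // mn sqr_sqrtr.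
have [v vE v0] := eigenvalueP ha.
(* [eigenvalue] speaks of row eigenvectors; A A^T is symmetric, so transposing gives a column
   one. *)
have : (A *m A^T) *m v^T = a *: v^T.
  by rewrite -linearZ -vE /= !trmx_mul trmxK.
move=> /(congr1 (dotv v^T)); rewrite -mulmxA dotv_mulmx dotvZr => h.
rewrite leNgt; apply/negP => a0.
have vv : 0 < dotv v^T v^T.
  rewrite lt_neqAle dotv_ge0 andbT eq_sym; apply: contra_neq v0.
  by move=> /dotv_eq0 v0; rewrite -[v]trmxK v0 trmx0.
have := dotv_ge0 (A^T *m v^T); rewrite h leNgt => /negP; apply.
by rewrite nmulr_rlt0.
Qed.

Lemma norm2_trmx_ge m n (A : 'M[R]_(m, n)) c :
  \rank A = m -> 0 <= c -> (forall s, singular_value A s -> c <= s) ->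
  forall y, c * norm2 y <= norm2 (A^T *m y).
Proof.
move=> rA c0 hc y.
have mn : (m <= n)%N by rewrite -rA rank_leq_col.
suff : c ^+ 2 * dotv y y <= dotv y (A *m A^T *m y).
  rewrite -mulmxA dotv_mulmx -!sqr_norm2 -exprMn.
  by rewrite ler_pXn2r ?nnegrE ?mulr_ge0 ?norm2_ge0.
apply: le_eigenvalue_dotv => [|a ha].
- by rewrite trmx_mul trmxK.
- have [a0 /hc h] := singular_value_sqrt mn ha.
  by rewrite -(sqr_sqrtr a0) lerXn2r ?nnegrE ?sqrtr_ge0.
Qed.

Lemma norm2_trmx_le m n (A : 'M[R]_(m, n)) c :
  \rank A = m -> 0 <= c -> (forall s, singular_value A s -> s <= c) ->
  forall y, norm2 (A^T *m y) <= c * norm2 y.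
Proof.
move=> rA c0 hc y.
have mn : (m <= n)%N by rewrite -rA rank_leq_col.
(* The Rayleigh bound is a lower one, so the upper bound is obtained from the spectrum of - A
   A^T. *)
suff : - c ^+ 2 * dotv y y <= dotv y (- (A *m A^T) *m y).
  rewrite mulNmx dotvNr mulNr lerN2 -mulmxA dotv_mulmx -!sqr_norm2 -exprMn.
  by rewrite ler_pXn2r ?nnegrE ?mulr_ge0 ?norm2_ge0.
apply: le_eigenvalue_dotv => [|a ha].
- by rewrite linearN /= trmx_mul trmxK.
- have {}ha : eigenvalue (A *m A^T) (- a).
    have [v vE v0] := eigenvalueP ha.
    by apply/eigenvalueP; exists v => //; rewrite scaleNr -vE mulmxN opprK.
  have [a0 /hc h] := singular_value_sqrt mn ha.
  by rewrite lerNl -(sqr_sqrtr a0) lerXn2r ?nnegrE ?sqrtr_ge0.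
Qed.

(** A matrix and its transpose have the same operator norm: |A x|^2 = x.(A^T A x), followed by
    Cauchy-Schwarz and cancellation of |A x|. *)
Lemma norm2_mulmx_le m n (A : 'M[R]_(m, n)) c :
  0 <= c -> (forall y, norm2 (A^T *m y) <= c * norm2 y) ->
  forall x, norm2 (A *m x) <= c * norm2 x.
Proof.
move=> c0 hc x; have := norm2_ge0 (A *m x); rewrite le_eqVlt => /predU1P[<-|Ax0].
  by rewrite mulr_ge0 ?norm2_ge0.
rewrite -(ler_pM2r Ax0) -expr2 sqr_norm2 dotv_mulmx dotvC.
apply: le_trans (ler_norm _) (le_trans (dotv_le_norm2 _ _) _).
by have := hc (A *m x); have := norm2_ge0 x; nra.
Qed.

(** The diagonal entries of Q are its eigenvalues on the unit vectors, hence lie between 0 and c,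
    and the inequality holds entry by entry. *)
Lemma norm2_diag_le n (Q : 'M[R]_n) c :
  is_diag_mx Q -> psd Q -> 0 <= c -> (forall a, eigenvalue Q a -> a <= c) ->
  forall x, norm2 (Q *m x) <= c * norm2 x.
Proof.
move=> /is_diag_mxP Qd [_ Q0] c0 hc x.
have QE (v : 'cV[R]_n) i : (Q *m v) i ord0 = Q i i * v i ord0.
  rewrite mxE (bigD1 i) //= big1 ?addr0 // => j ji.
  by rewrite Qd ?mul0r // eq_sym.
have Qi i : 0 <= Q i i <= c.
  apply/andP; split.
    have := Q0 (delta_mx i ord0); rewrite dotvE (bigD1 i) //= big1.
      by rewrite QE !mxE !eqxx mulr1 mul1r addr0.
    by move=> j ji; rewrite mxE (negPf ji) mul0r.
  apply: hc; apply/eigenvalueP; exists (delta_mx ord0 i).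
    rewrite -rowE; apply/rowP => j; rewrite !mxE eqxx /=.
    have [->|ji] := eqVneq j i; first by rewrite mulr1.
    by rewrite mulr0 Qd // eq_sym.
  by apply/eqP => /rowP/(_ i); rewrite !mxE !eqxx; apply/eqP/oner_neq0.
apply: norm2_le; first by rewrite mulr_ge0 ?norm2_ge0.
rewrite exprMn sqr_norm2 !dotvE mulr_sumr; apply: ler_sum => i _.
have /andP[q0 qc] := Qi i.
rewrite QE mulrACA -!expr2 ler_wpM2r ?sqr_ge0 //.
by rewrite lerXn2r ?nnegrE.
Qed.

End Spectral.

(** * The semi-norm *)

(* Each product [M *m x] is abstracted as a vector, so that the identity can be
   checked entrywise. *)
Ltac vring :=
  do 4! rewrite ?(mulmxDl, mulmxDr, mulmxN, mulNmx, mulmxBr, mulmxBl) -?scalemxAl -?scalemxAr;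
  repeat match goal with
  | |- context [@mulmx _ _ _ _ ?M ?x] =>
      let v := fresh "v" in set v := (M *m x); move: v => v
  end;
  apply/matrixP => ? ?; rewrite !mxE; ring.

Section Seminorm.
Context {R : realType} {m n : nat} (P : qp R m n).
Local Notation A := (qpA P).
Local Notation Q := (qpQ P).
Implicit Types (b : 'cV[R]_m) (c : 'cV[R]_n).

Lemma seminormA_le b c x y z :
  A *m x = b -> - (Q *m x) + A^T *m y + z = c ->
  seminormA P b c <= norm2 (col_mx x z).
Proof.
move=> hb hc; apply: ge_inf; last by exists x, y, z.
by exists 0 => _ [x' [y' [z' [_ _ ->]]]]; exact: norm2_ge0.
Qed.

Context (rankA : \rank A = m).

(** A strict bound yields a witness without proving that the infimum is attained; each use leaves
    some slack for this. *)
Lemma seminormA_lt b c t : seminormA P b c < t ->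
  exists x y z, [/\ A *m x = b, - (Q *m x) + A^T *m y + z = c
    & norm2 (col_mx x z) < t].
Proof.
move=> /inf_lt [|_ [x [y [z [hx hz ->]]]] lt_t]; last by exists x, y, z.
have rfA : row_free A by rewrite /row_free rankA.
(* Full row rank makes the constraints consistent: a right inverse of A solves the first one and z
   absorbs the second, so the infimum is over a nonempty set. *)
exists (norm2 (col_mx (pinvmx A *m b) (c + Q *m (pinvmx A *m b)))).
exists (pinvmx A *m b), 0, (c + Q *m (pinvmx A *m b)); split=> //.
  by rewrite mulmxA mulmxVp // mul1mx.
by rewrite mulmx0 addr0 addrC addrK.
Qed.

Lemma seminormAD b c b' c' :
  seminormA P (b + b') (c + c') <= seminormA P b c + seminormA P b' c'.
Proof.
apply/ler_addgt0Pr => e e0.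
have e2 : 0 < e / 2 by rewrite divr_gt0.
have [|x [y [z [hb hc h]]]] := @seminormA_lt b c (seminormA P b c + e / 2).
  by rewrite ltrDl.
have [|x' [y' [z' [hb' hc' h']]]] := @seminormA_lt b' c' (seminormA P b' c' + e / 2).
  by rewrite ltrDl.
apply: (le_trans (@seminormA_le _ _ (x + x') (y + y') (z + z') _ _)).
- by rewrite mulmxDr hb hb'.
- by rewrite -hc -hc'; vring.
have := norm2D (col_mx x z) (col_mx x' z'); rewrite -add_col_mx; lra.
Qed.

Lemma seminormAZ a b c : 0 <= a ->
  seminormA P (a *: b) (a *: c) <= a * seminormA P b c.
Proof.
rewrite le_eqVlt => /predU1P[<-|a0].
  rewrite !scale0r mul0r -[leRHS](@norm2_0 R (n + n)) -col_mx0.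
  by apply: (@seminormA_le _ _ 0 0 0); rewrite ?mulmx0 ?oppr0 ?addr0.
apply/ler_addgt0Pr => e e0.
have [|x [y [z [hb hc h]]]] := @seminormA_lt b c (seminormA P b c + e / a).
  by rewrite ltrDl divr_gt0.
apply: (le_trans (@seminormA_le _ _ (a *: x) (a *: y) (a *: z) _ _)).
- by rewrite -scalemxAr hb.
- by rewrite -!scalemxAr -scalerN -!scalerDr hc.
rewrite -scale_col_mx norm2Z gtr0_norm //.
have -> : a * seminormA P b c + e = a * (seminormA P b c + e / a).
  by rewrite mulrDr mulrCA divff ?mulr1 // gt_eqF.
by rewrite ler_pM2l // ltW.
Qed.

(** The witness is the least-norm solution x = A^T (A A^T)^-1 b, with y = 0 and z = c + Q x. Writing
    x = A^T w gives |x|^2 = w.b and |w| <= |x| / Cmin, hence |x| <= |b| / Cmin independently of the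
    dimensions. *)
Lemma seminormA_le_norm2 (Cmin CQ : R) b c :
  0 < Cmin -> (forall s, singular_value A s -> Cmin <= s) ->
  0 <= CQ -> (forall x, norm2 (Q *m x) <= CQ * norm2 x) ->
  seminormA P b c <= (1 + (1 + CQ) / Cmin) * norm2 (col_mx b c).
Proof.
move=> Cm hA CQ0 hQ.
have ge_A := norm2_trmx_ge rankA (ltW Cm) hA.
have uG : A *m A^T \in unitmx.
  have : ~~ eigenvalue (A *m A^T) 0.
    have mn : (m <= n)%N by rewrite -rankA rank_leq_col.
    apply/negP => /(singular_value_sqrt mn)[_ /hA].
    by rewrite sqrtr0 leNgt Cm.
  by rewrite /eigenvalue /eigenspace raddf0 subr0 negbK kermx_eq0 row_free_unit.
pose w := invmx (A *m A^T) *m b; pose x := A^T *m w.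
have Ax : A *m x = b by rewrite /x mulmxA /w mulKVmx.
have x_b : Cmin * norm2 x <= norm2 b.
  have := norm2_ge0 x; rewrite le_eqVlt => /predU1P[<-|x0].
    by rewrite mulr0 norm2_ge0.
  rewrite -(ler_pM2r x0) -mulrA -expr2 sqr_norm2 /x -dotv_mulmx Ax.
  have := ge_A w; rewrite -/x => h1.
  have := le_trans (ler_norm _) (dotv_le_norm2 w b).
  by have := norm2_ge0 b; have := norm2_ge0 w; nra.
apply: (le_trans (@seminormA_le b c x 0 (c + Q *m x) Ax _)).
  by rewrite mulmx0 addr0 addrC addrK.
apply: le_trans (norm2_col_mx _ _) _.
have h1 := norm2D c (Q *m x); have h2 := hQ x.
have h3 := norm2_col_mxl b c; have h4 := norm2_col_mxr b c.
have h5 : norm2 x <= norm2 (col_mx b c) / Cmin.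
  by rewrite ler_pdivlMr // mulrC (le_trans x_b).
have h6 : (1 + CQ) * norm2 x <= (1 + CQ) * (norm2 (col_mx b c) / Cmin).
  by rewrite ler_wpM2l // addr_ge0.
lra.
Qed.

End Seminorm.

(** * Scaled complementarity equation *)

Section ScalingEnergy.
Context {R : realType}.

(** The equation is z (dx - u) + x (dz - w) = - x z + s mu - z u - x w; squared and divided by x z,
    its left side is the weighted energy plus the cross term. As x z >= g mu, a shift of size U mu
    costs (z u)^2 / (x z) <= U^2 mu z^2 / g: one factor mu survives. The 3 comes from (a + b + c)^2
    <= 3 (a^2 + b^2 + c^2). The second bound is Young's inequality with weight z / x, after
    splitting dx into dx - u and u. *)
Lemma scaled_step_le (g mu s x z u w dx dz U : R) :
  0 < g -> 0 < mu -> 0 <= s <= 1 -> 0 < x -> 0 < z -> g * mu <= x * z ->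
  `|u| <= U * mu -> `|w| <= U * mu ->
  z * dx + x * dz = - (x * z) + s * mu ->
  [/\ z / x * (dx - u) ^+ 2 + x / z * (dz - w) ^+ 2 + 2 * ((dx - u) * (dz - w))
        <= 3 * (x * z + mu / g) + 3 * (U ^+ 2 * mu / g) * (x ^+ 2 + z ^+ 2)
    & `|dx * dz| <= z / x * (dx - u) ^+ 2 + x / z * (dz - w) ^+ 2
        + U ^+ 2 * mu / g * (x ^+ 2 + z ^+ 2)].
Proof.
move=> g0 mu0 /andP[s0 s1] x0 z0 gxz hu hw hN.
have r0 : 0 < x * z by rewrite mulr_gt0.
have gmu0 : 0 < g * mu by rewrite mulr_gt0.
have inv_le a : 0 <= a -> a / (x * z) <= a / (g * mu).
  by move=> a0; rewrite ler_wpM2l // lef_pV2 ?posrE.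
have UE : U ^+ 2 * mu / g = (U * mu) ^+ 2 / (g * mu).
  by rewrite exprMn; field; rewrite !gt_eqF.
have U0 : 0 <= U * mu by apply: le_trans hu.
have sq v : `|v| <= U * mu -> v ^+ 2 <= (U * mu) ^+ 2.
  by move=> hv; rewrite -real_normK ?num_real // lerXn2r ?nnegrE.
have sqz (v y : R) : `|v| <= U * mu -> (y * v) ^+ 2 / (x * z) <= U ^+ 2 * mu / g * y ^+ 2.
  move=> hv; apply: le_trans (inv_le _ (sqr_ge0 _)) _.
  rewrite UE [leRHS]mulrAC ler_wpM2r ?invr_ge0 ?(ltW gmu0) //.
  by rewrite exprMn mulrC ler_wpM2r ?sqr_ge0 // sq.
have hzu := sqz u z hu; have hxw := sqz w x hw.
have hzu' : (z * u) ^+ 2 / (x * z) = z / x * u ^+ 2 by field; rewrite !gt_eqF.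
have hxw' : (x * w) ^+ 2 / (x * z) = x / z * w ^+ 2 by field; rewrite !gt_eqF.
have a0 : 0 < z / x by rewrite divr_gt0.
split.
- have -> : z / x * (dx - u) ^+ 2 + x / z * (dz - w) ^+ 2 + 2 * ((dx - u) * (dz - w))
      = (- (x * z) + s * mu - z * u - x * w) ^+ 2 / (x * z).
    by rewrite -hN; field; rewrite !gt_eqF.
  have hs : (- (x * z) + s * mu) ^+ 2 / (x * z) <= x * z + mu / g.
    apply: (@le_trans _ _ ((x * z) ^+ 2 / (x * z) + mu ^+ 2 / (x * z))).
      rewrite -mulrDl ler_wpM2r ?invr_ge0 ?(ltW r0) //.
      have h1 : 0 <= x * z * (s * mu) by rewrite !mulr_ge0 // ltW.
      have h2 : (s * mu) ^+ 2 <= mu ^+ 2.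
        by rewrite lerXn2r ?nnegrE ?mulr_ge0 ?(ltW mu0) // ler_piMl // ltW.
      by move: h1 h2; move: (x * z) (s * mu) => r t; rewrite !expr2; lra.
    have -> : (x * z) ^+ 2 / (x * z) = x * z by field; rewrite !gt_eqF.
    rewrite lerD2l (le_trans (inv_le _ (sqr_ge0 _))) //.
    by rewrite expr2 -mulf_div divff ?gt_eqF // mulr1.
  have cs : (- (x * z) + s * mu - z * u - x * w) ^+ 2
      <= 3 * ((- (x * z) + s * mu) ^+ 2 + (z * u) ^+ 2 + (x * w) ^+ 2).
    move: (- _ + _) (z * u) (x * w) => a b c.
    have := sqr_ge0 (a + b); have := sqr_ge0 (a + c); have := sqr_ge0 (b - c).
    rewrite !expr2; lra.
  have : (- (x * z) + s * mu - z * u - x * w) ^+ 2 / (x * z) <=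
      3 * ((- (x * z) + s * mu) ^+ 2 + (z * u) ^+ 2 + (x * w) ^+ 2) / (x * z).
    by rewrite ler_wpM2r // invr_ge0 ltW.
  move: hs hzu hxw; rewrite -!mulrA !mulrDl; lra.
- have := hzu; have := hxw; rewrite hzu' hxw'.
  have -> : x / z = (z / x)^-1 by rewrite invf_div.
  move: (z / x) a0 => a a0 h1 h2.
  have ai : 0 < a^-1 by rewrite invr_gt0.
  have key b c : 2 * `|b * c| <= a * b ^+ 2 + a^-1 * c ^+ 2.
    rewrite -[2]gtr0_norm // -normrM ler_norml.
    have e1 := mulr_ge0 (ltW ai) (sqr_ge0 (a * b + c)).
    have e2 := mulr_ge0 (ltW ai) (sqr_ge0 (a * b - c)).
    have E1 : a^-1 * (a * b + c) ^+ 2 = a * b ^+ 2 + a^-1 * c ^+ 2 + 2 * (b * c).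
      by field; rewrite gt_eqF.
    have E2 : a^-1 * (a * b - c) ^+ 2 = a * b ^+ 2 + a^-1 * c ^+ 2 - 2 * (b * c).
      by field; rewrite gt_eqF.
    by apply/andP; split; lra.
  have := key dx dz.
  have k1 := mulr_ge0 (ltW a0) (sqr_ge0 (dx - u - u)).
  have k2 := mulr_ge0 (ltW ai) (sqr_ge0 (dz - w - w)).
  rewrite !expr2 in h1 h2 k1 k2 *; lra.
Qed.

(** The energy W is at most T - 2 (dx - u).(dz - w), so a lower bound on this inner product, which
    the Newton equations supply, will bound the sum of all |dx_i dz_i|. *)
Lemma scaled_step_sum_le n (g mu s K U : R) (x z dx dz u w : 'cV[R]_n) :
  (0 < n)%N -> 0 < g -> 0 < mu -> 0 <= s <= 1 -> posv x -> posv z ->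
  (forall i, g * mu <= x i ord0 * z i ord0) -> dotv x z = n%:R * mu ->
  norm2 x <= K * n%:R -> norm2 z <= K * n%:R ->
  (forall i, `|u i ord0| <= U * mu) -> (forall i, `|w i ord0| <= U * mu) ->
  (forall i, z i ord0 * dx i ord0 + x i ord0 * dz i ord0
     = - (x i ord0 * z i ord0) + s * mu) ->
  let T := (3 + 3 / g + 6 * (U ^+ 2 / g * K ^+ 2)) * n%:R ^+ 2 * mu in
  2 * dotv (dx - u) (dz - w) <= T /\
  \sum_i `|dx i ord0 * dz i ord0| <= 2 * T - 2 * dotv (dx - u) (dz - w).
Proof.
move=> n0 g0 mu0 hs x0 z0 hg hxz hx hz hu hw hN T.
have N1 : 1 <= n%:R :> R by rewrite ler1n.
have step i := scaled_step_le g0 mu0 hs (x0 i) (z0 i) (hg i) (hu i) (hw i) (hN i).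
pose W := \sum_i (z i ord0 / x i ord0 * (dx i ord0 - u i ord0) ^+ 2
  + x i ord0 / z i ord0 * (dz i ord0 - w i ord0) ^+ 2).
have W0 : 0 <= W.
  apply: sumr_ge0 => i _; have xi := ltW (x0 i); have zi := ltW (z0 i).
  by rewrite addr_ge0 // mulr_ge0 ?sqr_ge0 // divr_ge0.
have C0 : 0 <= U ^+ 2 * mu / g by rewrite divr_ge0 ?(ltW g0) // mulr_ge0 ?sqr_ge0 ?(ltW mu0).
have sx := dotv_le_sqr hx; have sz := dotv_le_sqr hz.
have S2 : \sum_i (x i ord0 ^+ 2 + z i ord0 ^+ 2) <= 2 * (K ^+ 2 * n%:R ^+ 2).
  have sqE (v : 'cV[R]_n) : \sum_i v i ord0 ^+ 2 = dotv v v by rewrite dotvE.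
  by rewrite big_split /= !sqE -exprMn; lra.
have S3 : U ^+ 2 * mu / g * \sum_i (x i ord0 ^+ 2 + z i ord0 ^+ 2)
    <= 2 * (U ^+ 2 / g * K ^+ 2) * n%:R ^+ 2 * mu.
  apply: le_trans (ler_wpM2l C0 S2) _.
  by rewrite le_eqVlt; apply/orP; left; apply/eqP; field; rewrite gt_eqF.
have dE : dotv (dx - u) (dz - w)
    = \sum_i (dx i ord0 - u i ord0) * (dz i ord0 - w i ord0).
  by rewrite dotvE; apply: eq_bigr => i _; rewrite !mxE.
have Nmu : n%:R * (mu / g) + n%:R * mu <= (1 + g^-1) * n%:R ^+ 2 * mu.
  have := @ler_wpM2r _ ((1 + g^-1) * mu) _ n%:R (n%:R ^+ 2).
  rewrite mulr_ge0 ?(ltW mu0) // ?addr_ge0 ?invr_ge0 ?(ltW g0) //.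
  by rewrite expr2 ler_peMr // => /(_ isT isT); lra.
have h1 : W + 2 * dotv (dx - u) (dz - w) <= T.
  apply: (@le_trans _ _ (3 * (dotv x z + n%:R * (mu / g)) +
    3 * (U ^+ 2 * mu / g * \sum_i (x i ord0 ^+ 2 + z i ord0 ^+ 2)))).
    have -> : n%:R * (mu / g) = \sum_(i < n) mu / g.
      by rewrite sumr_const card_ord mulr_natl.
    rewrite dE /W !mulr_sumr -big_split dotvE -big_split /= !mulr_sumr -big_split /=.
    by apply: ler_sum => i _; have [h _] := step i; lra.
  by rewrite hxz /T; lra.
split; first by lra.
have h2 : \sum_i `|dx i ord0 * dz i ord0|
    <= W + U ^+ 2 * mu / g * \sum_i (x i ord0 ^+ 2 + z i ord0 ^+ 2).
  rewrite /W mulr_sumr -big_split /=.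
  by apply: ler_sum => i _; have [_ h] := step i.
have T0 : 2 * (U ^+ 2 / g * K ^+ 2) * n%:R ^+ 2 * mu <= T.
  rewrite /T ler_wpM2r ?(ltW mu0) // ler_wpM2r ?sqr_ge0 //.
  have : 0 <= U ^+ 2 / g * K ^+ 2 by rewrite mulr_ge0 ?divr_ge0 ?sqr_ge0 // ltW.
  have : 0 < 3 / g by rewrite divr_gt0.
  lra.
lra.
Qed.

End ScalingEnergy.

(** * Bounds on the iterates *)

Section EntryBounds.
Context {R : realType}.

Lemma dotv_le_entries n (u v : 'cV[R]_n) a b :
  (forall i, 0 <= u i ord0 <= a) -> (forall i, 0 <= v i ord0 <= b) ->
  dotv u v <= a * b * n%:R.
Proof.
move=> hu hv; rewrite dotvE; apply: (@le_trans _ _ (\sum_(i < n) a * b)).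
  apply: ler_sum => i _; have /andP[u0 ua] := hu i; have /andP[v0 vb] := hv i.
  exact: ler_pM.
by rewrite sumr_const card_ord mulr_natr.
Qed.

Lemma dotv_ge_sum n (u v : 'cV[R]_n) a :
  (forall i, 0 <= u i ord0) -> (forall i, a <= v i ord0) ->
  a * \sum_i u i ord0 <= dotv u v.
Proof.
move=> hu hv; rewrite dotvE mulr_sumr; apply: ler_sum => i _.
by rewrite mulrC ler_wpM2l.
Qed.

End EntryBounds.

Section Bounds.
Context {R : realType} (p : ippmm_params R).
Context (rho Cy Cstar Cmin Cmax CQ Cr : R).

(** The entries of the reference points [x0 + xh], [z0 + zh] are at least
    [ref_low] and at most [2 * rho]. *)
Definition ref_low : R := (1 - gamma_A p) / 2 * rho.
(** Four of the five rho^2 come from [gap_le]; the fifth is x.z = n mu = n theta rho^2. *)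
Definition gap_const : R := 5 * rho ^+ 2 + 4 * rho * Cstar.
Definition yhat_const : R := (C_N p + (CQ + 1) * rho) / Cmin.
Definition ref_const : R := 2 * rho + Cstar + Cy + yhat_const.
Definition cbar_const : R := CQ * rho + Cmax * Cy + rho + Cr.
Definition bbar_const : R := Cmax * rho + Cr.
Definition sum_const : R := gap_const / ref_low.
Definition y_const : R := (Cr + cbar_const + C_N p + (CQ + 1) * sum_const) / Cmin.
(** The summands rho and Cy cover the initial estimates, the other two those set by an update. *)
Definition est_const : R := rho + Cy + sum_const + y_const.
(** The leading 1 makes the constant at least its own square root, so it bounds the norm as well as
    its square. *)
Definition dist_const : R :=
  1 + 2 * gap_const / rho ^+ 2 + 2 * (ref_const + est_const) ^+ 2.
(** One [est_const] passes from the reference point to the estimate; the second is kept for adding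
    zeta or lam back. *)
Definition xy_const : R := dist_const + ref_const + 2 * est_const.
Definition z_const : R :=
  Cr + cbar_const + C_N p + (CQ + Cmax + rho ^+ 2) * xy_const.
Definition iter_const : R := xy_const + z_const.

Context (hp : valid_params p).
Context (hrho : 0 < rho).
Context (hCy : 0 <= Cy).
Context (hCstar : 0 <= Cstar).
Context (hCmin : 0 < Cmin).
Context (hCmax : 0 < Cmax).
Context (hCQ : 0 < CQ).
Context (hCr : 0 < Cr).

(* [lra] ignores section hypotheses unless they are copied into the goal. *)
Ltac signs := move: (hrho) (hCy) (hCstar) (hCmin) (hCmax) (hCQ) (hCr) => ? ? ? ? ? ? ?.
Ltac slra := signs; lra.

Let hCN : 0 < C_N p. Proof. by case: hp. Qed.
Let hgA : 0 < gamma_A p < 1. Proof. by case: hp. Qed.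

Lemma ref_low_gt0 : 0 < ref_low.
Proof. by rewrite mulr_gt0 // divr_gt0 // subr_gt0; case/andP: hgA. Qed.

Lemma gap_const_gt0 : 0 < gap_const.
Proof. by rewrite ltr_wpDr ?mulr_gt0 ?exprn_gt0 // mulr_ge0 // mulr_ge0 // ltW. Qed.

Lemma yhat_const_gt0 : 0 < yhat_const.
Proof. by rewrite divr_gt0 // addr_gt0 // mulr_gt0 // addr_gt0. Qed.

Lemma ref_const_gt0 : 0 < ref_const.
Proof. have := yhat_const_gt0; rewrite /ref_const; slra. Qed.

Lemma cbar_const_gt0 : 0 < cbar_const.
Proof.
have := mulr_gt0 hCQ hrho; have := mulr_ge0 (ltW hCmax) hCy.
rewrite /cbar_const; slra.
Qed.

Lemma bbar_const_gt0 : 0 < bbar_const.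
Proof. by rewrite addr_gt0 // mulr_gt0. Qed.

Lemma sum_const_gt0 : 0 < sum_const.
Proof. by rewrite divr_gt0 // ?gap_const_gt0 ?ref_low_gt0. Qed.

Lemma y_const_gt0 : 0 < y_const.
Proof.
rewrite divr_gt0 //; have h1 := cbar_const_gt0; have h2 := sum_const_gt0.
have := mulr_gt0 hCQ h2; have := hCN; slra.
Qed.

Lemma est_const_gt0 : 0 < est_const.
Proof. have := sum_const_gt0; have := y_const_gt0; rewrite /est_const; slra. Qed.

Lemma dist_const_ge1 : 1 <= dist_const.
Proof.
rewrite /dist_const -addrA lerDl addr_ge0 //.
  by rewrite divr_ge0 ?sqr_ge0 // mulr_ge0 // ltW // gap_const_gt0.
by rewrite mulr_ge0 // sqr_ge0.
Qed.

Lemma xy_const_gt0 : 0 < xy_const.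
Proof.
have := dist_const_ge1; have := ref_const_gt0; have := est_const_gt0.
rewrite /xy_const; slra.
Qed.

Lemma z_const_gt0 : 0 < z_const.
Proof.
have h1 := cbar_const_gt0; have h2 := xy_const_gt0.
have := mulr_gt0 hCQ h2; have := mulr_gt0 hCmax h2; have := hCN.
have := mulr_gt0 (exprn_gt0 2 hrho) h2; rewrite /z_const; slra.
Qed.

Context {m n : nat} (P : qp R m n) (y0 : 'cV[R]_m).
Local Notation A := (qpA P).
Local Notation Q := (qpQ P).
Local Notation b := (qpb P).
Local Notation c := (qpc P).
Local Notation N := (n%:R : R).
Local Notation x0 := (x0 rho : 'cV[R]_n).
Local Notation z0 := (z0 rho : 'cV[R]_n).
Local Notation bbar := (bbar P rho).
Local Notation cbar := (cbar P rho y0).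

Context (n_gt0 : (0 < n)%N).
Context (rankA : \rank A = m).
Context (A_sv : forall s, singular_value A s -> Cmin <= s).
Context (A_ge : forall y, Cmin * norm2 y <= norm2 (A^T *m y)).
Context (AT_le : forall y, norm2 (A^T *m y) <= Cmax * norm2 y).
Context (A_le : forall x, norm2 (A *m x) <= Cmax * norm2 x).
Context (Q_le : forall x, norm2 (Q *m x) <= CQ * norm2 x).
Context (Q_ge0 : forall x, 0 <= dotv x (Q *m x)).
Context (b_le : norm2 b <= Cr * N).
Context (c_le : norm2 c <= Cr * N).
Context (y0_le : norm2 y0 <= Cy * N).
Context (xo : 'cV[R]_n) (yo : 'cV[R]_m) (zo : 'cV[R]_n).
Context (xo_feas : A *m xo = b).
Context (yo_feas : - (Q *m xo) + A^T *m yo + zo = c).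
Context (xo_bound : forall i, 0 <= xo i ord0 <= Cstar).
Context (zo_bound : forall i, 0 <= zo i ord0 <= Cstar).
Context (yo_le : norm2 yo <= Cstar * N).
Context (xzo : dotv xo zo = 0).

Let N_ge1 : 1 <= N. Proof. by rewrite ler1n. Qed.

Lemma mu0E : @mu0 R n rho = rho ^+ 2.
Proof.
rewrite /mu0 /duality_measure dotvE.
under eq_bigr do rewrite !mxE mulr1 -expr2.
by rewrite sumr_const card_ord -[X in X / _]mulr_natr mulfK // pnatr_eq0 -lt0n.
Qed.

Lemma rho_le_N : rho <= rho * N. Proof. by rewrite ler_peMr // ltW. Qed.

Lemma x0_le : norm2 x0 <= rho * N.
Proof.
by apply: norm2_le_entries => i; rewrite !mxE mulr1 gtr0_norm.
Qed.

Lemma norm2_entries_le (v : 'cV[R]_n) a : (forall i, 0 <= v i ord0 <= a) ->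
  norm2 v <= a * N.
Proof.
by move=> h; apply: norm2_le_entries => i; have /andP[v0 va] := h i; rewrite ger0_norm.
Qed.

Lemma cbar_le : norm2 cbar <= cbar_const * N.
Proof.
rewrite /cbar /cbar_const.
have h1 := norm2B (- (Q *m x0) + A^T *m y0 + z0) c.
have h2 := norm2D (- (Q *m x0) + A^T *m y0) z0.
have h3 := norm2D (- (Q *m x0)) (A^T *m y0).
have h4 := Q_le x0; have h5 := AT_le y0; rewrite norm2N in h3.
have h6 := x0_le; have h7 : CQ * norm2 x0 <= CQ * (rho * N) by rewrite ler_pM2l.
have h8 : Cmax * norm2 y0 <= Cmax * (Cy * N) by rewrite ler_pM2l.
have h9 : norm2 z0 <= rho * N := x0_le; have := c_le; lra.
Qed.

Lemma bbar_le : norm2 bbar <= bbar_const * N.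
Proof.
rewrite /bbar /bbar_const.
have h1 := norm2B (A *m x0) b; have h4 := A_le x0.
have h6 := x0_le; have h7 : Cmax * norm2 x0 <= Cmax * (rho * N) by rewrite ler_pM2l.
have := b_le; lra.
Qed.

Lemma y_le_of_dual (x z c' : 'cV[R]_n) (y : 'cV[R]_m) :
  - (Q *m x) + A^T *m y + z = c' ->
  Cmin * norm2 y <= norm2 c' + CQ * norm2 x + norm2 z.
Proof.
move=> h; apply: le_trans (A_ge y) _.
have -> : A^T *m y = c' + Q *m x - z by rewrite -h; vring.
have h1 := norm2B (c' + Q *m x) z; have h2 := norm2D c' (Q *m x).
have := Q_le x; lra.
Qed.

(** Of the gap (1 - gamma_A) rho between the semi-norm bound and rho, one half pays for a possibly
    unattained infimum and the other half is [ref_low]. The semi-norm says nothing about yh, which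
    is recovered from A^T yh = ct + Q xh - zh and the lower bound on A^T. *)
Lemma hat_witness bt ct :
  norm2 (col_mx bt ct) <= C_N p -> seminormA P bt ct <= gamma_A p * rho ->
  exists xh yh zh, [/\ A *m xh = bt, - (Q *m xh) + A^T *m yh + zh = ct,
    norm2 (col_mx xh zh) <= rho - ref_low & norm2 yh <= yhat_const].
Proof.
move=> hN hS.
have /andP[g0 g1] := hgA.
have lt_rho : gamma_A p * rho < rho - ref_low by have := ref_low_gt0; rewrite /ref_low; lra.
have [xh [yh [zh [hb hc /ltW hxz]]]] := seminormA_lt rankA (le_lt_trans hS lt_rho).
exists xh, yh, zh; split => //.
have le_rho : norm2 (col_mx xh zh) <= rho.
  by apply: le_trans hxz _; rewrite lerBlDr lerDl ltW // ref_low_gt0.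
rewrite /yhat_const ler_pdivlMr // mulrC.
have := y_le_of_dual hc.
have h1 := le_trans (norm2_col_mxl xh zh) le_rho.
have h2 := le_trans (norm2_col_mxr xh zh) le_rho.
have h3 := le_trans (norm2_col_mxr bt ct) hN.
have h4 : CQ * norm2 xh <= CQ * rho by rewrite ler_pM2l.
lra.
Qed.

Lemma shifted_bound (v : 'cV[R]_n) i : norm2 v <= rho - ref_low ->
  ref_low <= (x0 + v) i ord0 <= 2 * rho.
Proof.
move=> h; rewrite !mxE mulr1; have := abs_le_norm2 v i.
have h0 := ref_low_gt0; rewrite ler_norml => /andP[]; slra.
Qed.

(* Expands the product at the convex combination of the shifted starting point
   and the complementary optimal pair; the terms with zo and xo only help. *)
Lemma gap_le theta (xh zh x z : 'cV[R]_n) :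
  0 <= theta <= 1 -> norm2 (col_mx xh zh) <= rho - ref_low ->
  (forall i, 0 <= x i ord0) -> (forall i, 0 <= z i ord0) ->
  dotv (x - (theta *: (x0 + xh) + (1 - theta) *: xo))
       (z - (theta *: (z0 + zh) + (1 - theta) *: zo)) <=
  dotv x z + theta * ((4 * rho ^+ 2 + 4 * rho * Cstar) * N)
  - theta * (ref_low * (\sum_i x i ord0 + \sum_i z i ord0)).
Proof.
move=> /andP[t0 t1] hh hx hz.
have hxt i := shifted_bound i (le_trans (norm2_col_mxl xh zh) hh).
have hzt i := shifted_bound i (le_trans (norm2_col_mxr xh zh) hh).
have r0 := ref_low_gt0.
set xt := x0 + xh in hxt *; set zt := z0 + zh.
have {}hzt i : ref_low <= zt i ord0 <= 2 * rho := hzt i.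
clearbody xt zt.
have hxt0 i : 0 <= xt i ord0 <= 2 * rho by have /andP[] := hxt i; lra.
have hzt0 i : 0 <= zt i ord0 <= 2 * rho by have /andP[] := hzt i; lra.
have e1 := dotv_le_entries hxt0 hzt0.
have e2 := dotv_le_entries hxt0 zo_bound.
have e3 := dotv_le_entries hzt0 xo_bound.
have l1 : ref_low * \sum_i x i ord0 <= dotv x zt.
  by apply: dotv_ge_sum => // i; case/andP: (hzt i).
have l2 : ref_low * \sum_i z i ord0 <= dotv z xt.
  by apply: dotv_ge_sum => // i; case/andP: (hxt i).
have l3 : 0 <= dotv x zo by apply: dotv_nonneg => // i; case/andP: (zo_bound i).
have l4 : 0 <= dotv z xo by apply: dotv_nonneg => // i; case/andP: (xo_bound i).
have p1 : 0 <= dotv xt zt.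
  by apply: dotv_nonneg => i; [case/andP: (hxt0 i) | case/andP: (hzt0 i)].
have p2 : 0 <= dotv xt zo.
  by apply: dotv_nonneg => i; [case/andP: (hxt0 i) | case/andP: (zo_bound i)].
have p3 : 0 <= dotv zt xo.
  by apply: dotv_nonneg => i; [case/andP: (hzt0 i) | case/andP: (xo_bound i)].
rewrite !dotv_bilin xzo (dotvC xt z) (dotvC xo z) (dotvC xo zt).
move: (dotv x z) (dotv x zt) (dotv x zo) (dotv z xt) (dotv z xo) (dotv xt zt)
  (dotv xt zo) (dotv zt xo) (\sum_i x i ord0) (\sum_i z i ord0)
  e1 e2 e3 l1 l2 l3 l4 p1 p2 p3.
move=> xz xzt xzo' zxt zxo xtzt xtzo ztxo Sx Sz e1 e2 e3 l1 l2 l3 l4 p1 p2 p3.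
have q1 : theta * (ref_low * Sx) <= theta * xzt by rewrite ler_wpM2l.
have q2 : theta * (ref_low * Sz) <= theta * zxt by rewrite ler_wpM2l.
have t1' : 0 <= 1 - theta by lra.
have q3 := mulr_ge0 t1' l3; have q4 := mulr_ge0 t1' l4.
have q5 : theta * (theta * xtzt) <= theta * (2 * rho * (2 * rho) * N).
  by rewrite ler_wpM2l // (le_trans _ e1) // ler_piMl.
have q6 : theta * ((1 - theta) * xtzo) <= theta * (2 * rho * Cstar * N).
  by rewrite ler_wpM2l // (le_trans _ e2) // ler_piMl //; lra.
have q7 : theta * ((1 - theta) * ztxo) <= theta * (2 * rho * Cstar * N).
  by rewrite ler_wpM2l // (le_trans _ e3) // ler_piMl //; lra.
rewrite expr2; lra.
Qed.

(** The reference point solves the perturbed equations with the proximal terms dropped. Hence A d =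
    - mu (y - lam), which removes A from d.f and leaves d.Qd >= 0 and the two proximal products. *)
Lemma neighborhood_reference mu zeta lam x y z :
  neighborhood P p rho y0 mu zeta lam x y z -> dotv x z = N * mu ->
  0 < mu <= rho ^+ 2 ->
  exists xr yr,
  [/\ norm2 xr <= ref_const * N, norm2 yr <= ref_const * N
    & ref_low * (\sum_i x i ord0 + \sum_i z i ord0)
      + rho ^+ 2 * (dotv (x - xr) (x - zeta) + dotv (y - yr) (y - lam))
      <= gap_const * N].
Proof.
move=> [x_gt0 z_gt0 _ [bt [ct [e1 e2 hN hS]]]] xzE /andP[mu_gt0 mu_le].
have [xh [yh [zh [hb hc hxz hy]]]] := hat_witness hN hS.
have r2 : 0 < rho ^+ 2 by rewrite exprn_gt0.
pose theta := mu / rho ^+ 2; rewrite mu0E -/theta in e1 e2.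
have muE : mu = theta * rho ^+ 2 by rewrite /theta mulfVK // gt_eqF.
have t0 : 0 < theta by rewrite divr_gt0.
have t1 : theta <= 1 by rewrite ler_pdivrMr // mul1r.
clearbody theta.
pose xr := theta *: (x0 + xh) + (1 - theta) *: xo.
pose yr := theta *: (y0 + yh) + (1 - theta) *: yo.
pose zr := theta *: (z0 + zh) + (1 - theta) *: zo.
have Axr : A *m xr = A *m x + mu *: (y - lam).
  by rewrite e1 /xr /Defs.bbar -hb -xo_feas; vring.
have dxr : - (Q *m xr) + A^T *m yr + zr
    = - (Q *m x) + A^T *m y + z - mu *: (x - zeta).
  by rewrite e2 /xr /yr /zr /Defs.cbar -hc -yo_feas; vring.
have hgap := @gap_le theta xh zh x z _ hxz (fun i => ltW (x_gt0 i)) (fun i => ltW (z_gt0 i)).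
rewrite (ltW t0) t1 -/xr -/zr in hgap; have {}hgap := hgap isT.
have t0' := ltW t0.
have hxh := le_trans (norm2_col_mxl xh zh) hxz.
have hr := ref_low_gt0; have hrN := rho_le_N.
have ub (k : nat) (u v w : 'cV[R]_k) a b' c' : norm2 u <= a -> norm2 v <= b' ->
    norm2 w <= c' -> norm2 (theta *: (u + v) + (1 - theta) *: w) <= a + b' + c'.
  move=> hu hv hw.
  have := norm2D (theta *: (u + v)) ((1 - theta) *: w).
  rewrite !norm2Z (ger0_norm t0') ger0_norm ?subr_ge0 //.
  have := norm2D u v; have := norm2_ge0 (u + v); have := norm2_ge0 w.
  by move: t0 t1; nra.
have hK : 0 < yhat_const := yhat_const_gt0.
have N1 := N_ge1.
have hKN : yhat_const <= yhat_const * N by rewrite ler_peMr // ltW.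
have hCs : 0 <= Cstar * N by rewrite mulr_ge0 // ltW.
have hCy' : 0 <= Cy * N by rewrite mulr_ge0 // ltW.
have hrho' : 0 <= rho * N by rewrite mulr_ge0 // ltW.
exists xr, yr; split.
- apply: le_trans (ub _ _ _ _ _ _ _ x0_le hxh (norm2_entries_le xo_bound)) _.
  by rewrite /ref_const; lra.
- apply: le_trans (ub _ _ _ _ _ _ _ y0_le hy yo_le) _.
  by rewrite /ref_const; lra.
(* The two sides of [dxr] are added as a difference that vanishes; what remains is an identity for
   [vring]. The same device serves for the Newton equations below. *)
have zE : z - zr = Q *m (x - xr) - A^T *m (y - yr) + mu *: (x - zeta).
  transitivity (Q *m (x - xr) - A^T *m (y - yr) + mu *: (x - zeta) +
    ((- (Q *m x) + A^T *m y + z - mu *: (x - zeta)) -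
     (- (Q *m xr) + A^T *m yr + zr))); first by vring.
  by rewrite dxr subrr addr0.
have Ad : A *m (x - xr) = - (mu *: (y - lam)) by rewrite mulmxBr Axr; vring.
have dfE : dotv (x - xr) (z - zr) = dotv (x - xr) (Q *m (x - xr))
    + mu * (dotv (x - xr) (x - zeta) + dotv (y - yr) (y - lam)).
  rewrite zE; move: (x - zeta) (y - lam) Ad => g h Ad.
  rewrite !dotvDr dotvNr (dotv_mulmx A^T) trmxK Ad dotvNl dotvZl dotvZr.
  by rewrite (dotvC h); ring.
have := Q_ge0 (x - xr); move: hgap; rewrite dfE xzE muE => h1 h2.
(* Every term other than d.Qd carries the factor theta; dividing it out makes the bound uniform in
   mu. *)
rewrite -subr_le0 -(pmulr_rle0 _ t0) /gap_const.
move: h1 h2.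
move: (dotv _ (_ *m _)) (dotv (x - xr) (x - zeta)) (dotv (y - yr) _) (\sum_i x i ord0)
  (\sum_i z i ord0) => q u v s1 s2; lra.
Qed.

Lemma shifted_c_le theta ct : 0 <= theta <= 1 -> norm2 ct <= C_N p ->
  norm2 (c + theta *: (cbar + ct)) <= (Cr + cbar_const + C_N p) * N.
Proof.
move=> /andP[t0 t1] hct.
have h1 := norm2D c (theta *: (cbar + ct)); have h2 := norm2D cbar ct.
have h3 := norm2_ge0 (cbar + ct).
have h4 : theta * norm2 (cbar + ct) <= norm2 (cbar + ct) by rewrite ler_piMl.
have h5 : C_N p <= C_N p * N by rewrite ler_peMr // ltW.
have h6 := cbar_le; have h7 := c_le.
by move: h1; rewrite norm2Z ger0_norm //; lra.
Qed.

Lemma theta_bounds mu : 0 < mu <= rho ^+ 2 -> 0 <= mu / @mu0 R n rho <= 1.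
Proof.
move=> /andP[m0 m1]; have r2 : 0 < rho ^+ 2 by rewrite exprn_gt0.
rewrite mu0E; apply/andP; split; first by rewrite ltW // divr_gt0.
by rewrite ler_pdivrMr // mul1r.
Qed.

(** With zeta = x and lam = y the proximal products are 0, so the sums of the entries are bounded
    directly; y follows from the dual equation and the lower bound on A^T. *)
Lemma neighborhood_refreshed_le mu x y z :
  neighborhood P p rho y0 mu x y x y z -> dotv x z = N * mu ->
  0 < mu <= rho ^+ 2 ->
  norm2 x <= est_const * N /\ norm2 y <= est_const * N.
Proof.
move=> hnb xzE hmu.
have [xr [yr [_ _]]] := neighborhood_reference hnb xzE hmu.
rewrite !subrr !dotv0r addr0 mulr0 addr0 => hsum.
have [x_gt0 z_gt0 _ [bt [ct [_ e2 hN _]]]] := hnb.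
have nx := norm2_le_sum (fun i => ltW (x_gt0 i)).
have nz := norm2_le_sum (fun i => ltW (z_gt0 i)).
have x0' := norm2_ge0 x; have z0' := norm2_ge0 z.
have hs : \sum_i x i ord0 + \sum_i z i ord0 <= sum_const * N.
  by rewrite /sum_const mulrAC ler_pdivlMr ?ref_low_gt0 // mulrC.
have hx : norm2 x <= sum_const * N by lra.
have hz : norm2 z <= sum_const * N by lra.
have N1 := N_ge1; have hyc := y_const_gt0; have hsc := sum_const_gt0.
have hCyN : 0 <= Cy * N by rewrite mulr_ge0.
have hrN : 0 <= rho * N by rewrite mulr_ge0 // ltW.
have hyN : 0 <= y_const * N by rewrite mulr_ge0 // ltW.
have hsN : 0 <= sum_const * N by rewrite mulr_ge0 // ltW.
split; first by rewrite /est_const; lra.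
apply: (@le_trans _ _ (y_const * N)); last by rewrite /est_const; lra.
rewrite subrr scaler0 subr0 in e2.
have h1 := y_le_of_dual e2.
have h2 := shifted_c_le (theta_bounds hmu) (le_trans (norm2_col_mxr bt ct) hN).
have h3 : CQ * norm2 x <= CQ * (sum_const * N) by rewrite ler_pM2l.
rewrite /y_const mulrAC ler_pdivlMr // mulrC; lra.
Qed.

Lemma neighborhood_le mu zeta lam x y z :
  neighborhood P p rho y0 mu zeta lam x y z -> dotv x z = N * mu ->
  0 < mu <= rho ^+ 2 ->
  norm2 zeta <= est_const * N -> norm2 lam <= est_const * N ->
  [/\ norm2 x <= iter_const * N, norm2 z <= iter_const * N,
      norm2 (x - zeta) <= iter_const * N & norm2 (y - lam) <= iter_const * N].
Proof.
move=> hnb xzE hmu hzeta hlam.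
have [xr [yr [hxr hyr hE]]] := neighborhood_reference hnb xzE hmu.
have [x_gt0 z_gt0 _ [bt [ct [_ e2 hN _]]]] := hnb.
have r2 : 0 < rho ^+ 2 by rewrite exprn_gt0.
have N1 := N_ge1.
(* With s = u - v and t = v - w, this is 0 <= |s + t|^2 combined with |t| <= (ref_const + est_const)
   n: the proximal product controls the squared distance to the reference point. *)
have half (k : nat) (u v w : 'cV[R]_k) :
    norm2 v <= ref_const * N -> norm2 w <= est_const * N ->
    dotv (u - v) (u - v) <= 2 * dotv (u - v) (u - w)
      + (ref_const + est_const) ^+ 2 * N ^+ 2.
  move=> hv hw.
  have h1 := norm2B v w; have h2 : norm2 (v - w) <= (ref_const + est_const) * N by lra.
  have := dotv_le_sqr h2; rewrite exprMn.
  have := dotv_ge0 ((u - v) + (v - w)).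
  have -> : u - w = (u - v) + (v - w) by rewrite subrKA.
  move: (u - v) (v - w) => s t; rewrite !dotv_bilin (dotvC t s); lra.
have S0 : 0 <= \sum_i x i ord0 + \sum_i z i ord0.
  by rewrite addr_ge0 // sumr_ge0 // => i _; rewrite ltW.
have hd1 := half _ x _ _ hxr hzeta; have hd2 := half _ y _ _ hyr hlam.
have d1 := dotv_ge0 (x - xr); have d2 := dotv_ge0 (y - yr).
have N2 : N <= N ^+ 2 by rewrite expr2 ler_peMr.
have hT : dotv (x - xr) (x - zeta) + dotv (y - yr) (y - lam)
    <= gap_const / rho ^+ 2 * N ^+ 2.
  have hgN : gap_const * N <= gap_const * N ^+ 2 by rewrite ler_pM2l // gap_const_gt0.
  have hS := mulr_ge0 (ltW ref_low_gt0) S0.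
  by rewrite [leRHS]mulrAC ler_pdivlMr // [leLHS]mulrC; lra.
have hdist (k : nat) (u : 'cV[R]_k) :
    dotv u u <= dotv (x - xr) (x - xr) + dotv (y - yr) (y - yr) ->
    norm2 u <= dist_const * N.
  have D1 := dist_const_ge1.
  move=> hu; apply: norm2_le; first by rewrite mulr_ge0 // (le_trans ler01).
  have : dist_const * N ^+ 2 <= dist_const ^+ 2 * N ^+ 2.
    by rewrite ler_wpM2r ?sqr_ge0 // expr2 ler_peMr // (le_trans ler01).
  have := sqr_ge0 N; rewrite exprMn {1}/dist_const; lra.
have hx := hdist _ (x - xr) _; rewrite lerDl d2 in hx; have {}hx := hx isT.
have hy := hdist _ (y - yr) _; rewrite lerDr d1 in hy; have {}hy := hy isT.
have hez : norm2 (x - zeta) <= xy_const * N - est_const * N.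
  have h1 := norm2B xr zeta; have h2 := norm2D (x - xr) (xr - zeta).
  by rewrite subrKA in h2; rewrite /xy_const; lra.
have hel : norm2 (y - lam) <= xy_const * N - est_const * N.
  have h1 := norm2B yr lam; have h2 := norm2D (y - yr) (yr - lam).
  by rewrite subrKA in h2; rewrite /xy_const; lra.
have hxx : norm2 x <= xy_const * N.
  by have := norm2D (x - zeta) zeta; rewrite subrK; lra.
have hyy : norm2 y <= xy_const * N.
  by have := norm2D (y - lam) lam; rewrite subrK; lra.
have hE0 : 0 <= est_const * N by rewrite mulr_ge0 // ltW // est_const_gt0.
have hz : norm2 z <= z_const * N.
  have zE : z = c + mu / @mu0 R n rho *: (cbar + ct) + Q *m x - A^T *m y
      + mu *: (x - zeta) by rewrite -e2; vring.
  have /andP[m0 m1] := hmu.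
  rewrite zE.
  have h1 := norm2D (c + mu / @mu0 R n rho *: (cbar + ct) + Q *m x - A^T *m y)
    (mu *: (x - zeta)).
  have h2 := norm2B (c + mu / @mu0 R n rho *: (cbar + ct) + Q *m x) (A^T *m y).
  have h3 := norm2D (c + mu / @mu0 R n rho *: (cbar + ct)) (Q *m x).
  have h4 := shifted_c_le (theta_bounds hmu) (le_trans (norm2_col_mxr bt ct) hN).
  have h5 := Q_le x; have h6 := AT_le y.
  have h7 : CQ * norm2 x <= CQ * (xy_const * N) by rewrite ler_pM2l.
  have h8 : Cmax * norm2 y <= Cmax * (xy_const * N) by rewrite ler_pM2l.
  have h9 : mu * norm2 (x - zeta) <= rho ^+ 2 * (xy_const * N).
    by apply: ler_pM => //; [exact: ltW | exact: norm2_ge0 | lra].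
  by move: h1; rewrite norm2Z gtr0_norm // /z_const; lra.
have hxyN : 0 <= xy_const * N by rewrite mulr_ge0 // ltW // xy_const_gt0.
have hzN : 0 <= z_const * N by rewrite mulr_ge0 // ltW // z_const_gt0.
by rewrite /iter_const; split; lra.
Qed.

(** * Bounds on the Newton direction *)

(** Before the factor theta = mu / rho^2, an entry of the shift is at most 2 rho + Cstar from x0 +
    xh - xo, plus rho from each of xh and xk. *)
Definition shift_const : R := (4 * rho + Cstar) / rho ^+ 2.
Definition yshift_const : R := Cy + Cstar + 3 * yhat_const.
Definition force_const : R := iter_const + yshift_const + shift_const * rho ^+ 2.
Definition energy_const : R :=
  3 + 3 / gamma_mu p + 6 * (shift_const ^+ 2 / gamma_mu p * iter_const ^+ 2).
Definition dir_const : R :=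
  1 + 2 * energy_const + 2 * force_const ^+ 2 + shift_const * rho ^+ 2 + yshift_const.

(** Divided by theta, residuals satisfying (R) obey the bounds imposed on (bt, ct), as sigma_min / 4
    <= 1; so [hat_witness] applies to them too. *)
Lemma residual_hat_witness mu rp rd rmu :
  0 < mu -> residual_condition P p rho mu rp rd rmu ->
  let theta := mu / @mu0 R n rho in
  exists xh yh zh, [/\ theta *: (A *m xh) = rp,
    theta *: (- (Q *m xh) + A^T *m yh + zh) = rd,
    norm2 (col_mx xh zh) <= rho - ref_low & norm2 yh <= yhat_const].
Proof.
move=> mu_gt0 [_ hr hs] theta.
have r2 : 0 < rho ^+ 2 by rewrite exprn_gt0.
have t0 : 0 < theta by rewrite /theta mu0E divr_gt0.
have ti0 : 0 < theta^-1 by rewrite invr_gt0.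
have [/andP[sm0 sm1] sm2 CN0 /andP[g0 g1] _] := hp.
have sm4 : sigma_min p / 4 <= 1 by lra.
have coef a : sigma_min p / (4 * @mu0 R n rho) * a * mu = theta * (sigma_min p / 4 * a).
  by rewrite /theta mu0E; field; rewrite gt_eqF.
have hC : norm2 (col_mx (theta^-1 *: rp) (theta^-1 *: rd)) <= C_N p.
  rewrite -scale_col_mx norm2Z gtr0_norm // ler_pdivrMl //.
  by apply: le_trans hr _; rewrite coef ler_pM2l // ler_piMl // ltW.
have hS : seminormA P (theta^-1 *: rp) (theta^-1 *: rd) <= gamma_A p * rho.
  apply: le_trans (seminormAZ rankA _ _ (ltW ti0)) _.
  rewrite ler_pdivrMl //; apply: le_trans hs _.
  by rewrite -(mulrA _ (gamma_A p)) coef ler_pM2l // ler_piMl // mulr_ge0 // ltW.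
have [xh [yh [zh [hb hc hxz hy]]]] := hat_witness hC hS.
exists xh, yh, zh; split=> //.
  by rewrite hb scalerA divff ?scale1r // gt_eqF.
by rewrite hc scalerA divff ?scale1r // gt_eqF.
Qed.

Lemma newton_complementarity mu sigma zeta lam x y z dx dy dz rp rd rmu i :
  newton_system P rho y0 mu sigma zeta lam x y z dx dy dz rp rd rmu -> rmu = 0 ->
  z i ord0 * dx i ord0 + x i ord0 * dz i ord0 = - (x i ord0 * z i ord0) + sigma * mu.
Proof.
move=> [_ _ h] h0; move: h; rewrite h0 addr0 /diagv => /(congr1 (fun v : 'cV_n => v i ord0)).
by rewrite -mulmxA !mul_diag_mx !mxE !mulr1 opprB addrC => ->; rewrite addrC.
Qed.


Lemma shift_const_gt0 : 0 < shift_const.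
Proof. by rewrite divr_gt0 ?exprn_gt0 //; slra. Qed.

Lemma yshift_const_gt0 : 0 < yshift_const.
Proof. have := yhat_const_gt0; rewrite /yshift_const; slra. Qed.

Lemma iter_const_gt0 : 0 < iter_const.
Proof. by rewrite addr_gt0 ?xy_const_gt0 ?z_const_gt0. Qed.

Lemma energy_const_gt0 : 0 < energy_const.
Proof.
have [_ _ _ _ /andP[gm0 _]] := hp.
have k1 : 0 < 3 / gamma_mu p by rewrite divr_gt0.
have k2 : 0 <= shift_const ^+ 2 / gamma_mu p * iter_const ^+ 2.
  by apply: mulr_ge0; rewrite ?sqr_ge0 // divr_ge0 ?sqr_ge0 // ltW.
by rewrite /energy_const; lra.
Qed.

Lemma shift_entry_le theta sigma (a b' o : 'cV[R]_n) i :
  0 <= theta -> 0 <= sigma <= 1 ->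
  norm2 a <= rho - ref_low -> norm2 b' <= rho - ref_low ->
  (forall i, 0 <= o i ord0 <= Cstar) ->
  `|(theta *: (- ((1 - sigma) *: (x0 + a - o)) - sigma *: a + b')) i ord0|
    <= theta * (4 * rho + Cstar).
Proof.
move=> t0 /andP[sg0 sg1] ha hb' ho.
rewrite mxE normrM ger0_norm // ler_wpM2l //.
have h1 := shifted_bound i ha; have h2 := ho i.
have h3 := abs_le_norm2 a i; have h4 := abs_le_norm2 b' i.
have h0 := ref_low_gt0.
have -> : (- ((1 - sigma) *: (x0 + a - o)) - sigma *: a + b') i ord0
   = - ((1 - sigma) * ((x0 + a) i ord0 - o i ord0)) - sigma * a i ord0 + b' i ord0.
  by rewrite !mxE.
move: ((x0 + a) i ord0) (o i ord0) (a i ord0) (b' i ord0) h1 h2 h3 h4.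
move=> s1 s2 s3 s4 h1 h2 h3 h4.
have k1 : `|s1 - s2| <= 2 * rho + Cstar by rewrite ler_norml; slra.
have k2 : `|- ((1 - sigma) * (s1 - s2))| <= 2 * rho + Cstar.
  by rewrite normrN normrM ger0_norm ?subr_ge0 // (le_trans _ k1) // ler_piMl //; lra.
have k3 : `|sigma * s3| <= rho - ref_low.
  by rewrite normrM ger0_norm // (le_trans (ler_piMl _ sg1)) // (le_trans h3).
have := ler_normB (- ((1 - sigma) * (s1 - s2))) (sigma * s3).
have := ler_normD (- ((1 - sigma) * (s1 - s2)) - sigma * s3) s4.
lra.
Qed.

Lemma yshift_le theta sigma (yh yk : 'cV[R]_m) :
  0 <= theta <= 1 -> 0 <= sigma <= 1 ->
  norm2 yh <= yhat_const -> norm2 yk <= yhat_const ->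
  norm2 (theta *: (- ((1 - sigma) *: (y0 + yh - yo)) - sigma *: yh + yk))
    <= yshift_const * N.
Proof.
move=> /andP[t0 t1] /andP[sg0 sg1] hyh hyk.
have hyhN : yhat_const <= yhat_const * N by rewrite ler_peMr // ltW // yhat_const_gt0.
apply: (@le_trans _ _ (norm2 (- ((1 - sigma) *: (y0 + yh - yo)) - sigma *: yh + yk))).
  by rewrite norm2Z ger0_norm // ler_piMl // norm2_ge0.
have k1 := norm2D (- ((1 - sigma) *: (y0 + yh - yo)) - sigma *: yh) yk.
have k2 := norm2B (- ((1 - sigma) *: (y0 + yh - yo))) (sigma *: yh).
have k3 := norm2B (y0 + yh) yo; have k4 := norm2D y0 yh.
have k5 : (1 - sigma) * norm2 (y0 + yh - yo) <= norm2 (y0 + yh - yo).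
  by rewrite ler_piMl ?norm2_ge0 //; lra.
have k6 : sigma * norm2 yh <= norm2 yh by rewrite ler_piMl ?norm2_ge0.
rewrite norm2N !norm2Z !ger0_norm ?subr_ge0 // in k2.
have := y0_le; have := yo_le; rewrite /yshift_const; lra.
Qed.

(* The shift (u, v, w) absorbs all of the right-hand sides except the multiples
   mu * gp and mu * gd. *)
Lemma newton_shift mu sigma zeta lam x y z dx dy dz rp rd rmu :
  neighborhood P p rho y0 mu zeta lam x y z -> 0 < mu <= rho ^+ 2 ->
  0 <= sigma <= 1 ->
  newton_system P rho y0 mu sigma zeta lam x y z dx dy dz rp rd rmu ->
  residual_condition P p rho mu rp rd rmu ->
  exists u v w,
  let gp := (1 - sigma) *: (y - lam) - v in
  let gd := - ((1 - sigma) *: (x - zeta)) + u in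
  [/\ A *m (dx - u) = mu *: gp - mu *: (dy - v),
      dz - w = Q *m (dx - u) + mu *: (dx - u) - A^T *m (dy - v) + mu *: gd,
      forall i, `|u i ord0| <= shift_const * mu,
      forall i, `|w i ord0| <= shift_const * mu
    & norm2 v <= yshift_const * N].
Proof.
move=> hnb hmu hsig hnewt hres.
have /andP[mu_gt0 mu_le] := hmu.
have [_ _ _ [bt [ct [e1 e2 hN hS]]]] := hnb.
have [xh [yh [zh [hb hc hxzh hyh]]]] := hat_witness hN hS.
have [xk [yk [zk [hbk hck hxzk hyk]]]] := residual_hat_witness mu_gt0 hres.
have [n1 n2 _] := hnewt.
have r2 : 0 < rho ^+ 2 by rewrite exprn_gt0.
have := theta_bounds hmu; rewrite mu0E in e1 e2 hbk hck n1 n2 *.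
rewrite -[sigma * mu / _]mulrA in n1 n2.
set theta := mu / rho ^+ 2 in e1 e2 hbk hck n1 n2 *.
move=> ht; have /andP[t0 t1] := ht.
have thetaU : theta * (4 * rho + Cstar) = shift_const * mu.
  by rewrite /theta /shift_const; field; rewrite gt_eqF.
clearbody theta.
(* Since bbar = A (x0 - xo), bt = A xh and rp = theta A xk, A u is - (1 - sigma) theta bbar - theta
   bt + rp, the part of the Newton right-hand side free of y - lam. The triple (u, v, w) does the
   same for the dual equation. *)
pose u := theta *: (- ((1 - sigma) *: (x0 + xh - xo)) - sigma *: xh + xk).
pose v := theta *: (- ((1 - sigma) *: (y0 + yh - yo)) - sigma *: yh + yk).
pose w := theta *: (- ((1 - sigma) *: (z0 + zh - zo)) - sigma *: zh + zk).
exists u, v, w => gp gd; split.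
- transitivity (mu *: gp - mu *: (dy - v) + (A *m dx + mu *: dy
      - (- (A *m x + (sigma * mu) *: (y - lam) - (b + (sigma * theta) *: bbar)) + rp))
    - (A *m x + mu *: (y - lam) - (b + theta *: (bbar + bt)))).
    by rewrite /gp /u /v /Defs.bbar -hbk -hb -xo_feas; vring.
  by rewrite n2 e1 !subrr subr0 addr0.
- transitivity (Q *m (dx - u) + mu *: (dx - u) - A^T *m (dy - v) + mu *: gd
    + (- ((Q + mu%:M) *m dx) + A^T *m dy + dz
      - (- (- (c + (sigma * theta) *: cbar) - Q *m x + A^T *m y + z
             - (sigma * mu) *: (x - zeta)) + rd))
    - (- (Q *m x) + A^T *m y + z - mu *: (x - zeta) - (c + theta *: (cbar + ct)))).
    by rewrite /gd /u /v /w /Defs.cbar -hck -hc -yo_feas mulmxDl mul_scalar_mx; vring.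
  by rewrite n1 e2 !subrr subr0 addr0.
- move=> i; rewrite -thetaU; exact: (shift_entry_le i t0 hsig
    (le_trans (norm2_col_mxl _ _) hxzh) (le_trans (norm2_col_mxl _ _) hxzk) xo_bound).
- move=> i; rewrite -thetaU; exact: (shift_entry_le i t0 hsig
    (le_trans (norm2_col_mxr _ _) hxzh) (le_trans (norm2_col_mxr _ _) hxzk) zo_bound).
- exact: yshift_le.
Qed.

(** The first equation turns - d.(A^T e) into mu (|e|^2 - e.gp), so both d and e acquire a quadratic
    term; completing squares against gp and gd leaves half of each. *)
Lemma prox_energy_ge mu F (d f gd : 'cV[R]_n) (e gp : 'cV[R]_m) :
  0 < mu -> A *m d = mu *: gp - mu *: e ->
  f = Q *m d + mu *: d - A^T *m e + mu *: gd ->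
  norm2 gp <= F -> norm2 gd <= F ->
  mu * (dotv d d + dotv e e) - 2 * F ^+ 2 * mu <= 2 * dotv d f.
Proof.
move=> mu_gt0 eP eD hgp hgd.
have key : 2 * dotv d f = 2 * dotv d (Q *m d)
      + mu * (dotv d d + dotv e e)
      + mu * (dotv (d + gd) (d + gd) + dotv (e - gp) (e - gp))
      - mu * (dotv gd gd + dotv gp gp).
  rewrite eD !dotvDr !dotvNr (dotv_mulmx A^T) trmxK eP !dotv_bilin.
  by rewrite (dotvC gd d) (dotvC gp e); ring.
have k1 := Q_ge0 d.
have k2 : 0 <= mu * (dotv (d + gd) (d + gd) + dotv (e - gp) (e - gp)).
  by rewrite mulr_ge0 ?(ltW mu_gt0) // addr_ge0 ?dotv_ge0.
have k3 : mu * (dotv gd gd + dotv gp gp) <= mu * (2 * F ^+ 2).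
  by rewrite ler_pM2l //; have := dotv_le_sqr hgp; have := dotv_le_sqr hgd; lra.
rewrite key; lra.
Qed.

Lemma newton_le mu sigma zeta lam x y z dx dy dz rp rd rmu :
  neighborhood P p rho y0 mu zeta lam x y z -> dotv x z = N * mu ->
  0 < mu <= rho ^+ 2 ->
  norm2 zeta <= est_const * N -> norm2 lam <= est_const * N ->
  0 <= sigma <= 1 ->
  newton_system P rho y0 mu sigma zeta lam x y z dx dy dz rp rd rmu ->
  residual_condition P p rho mu rp rd rmu ->
  [/\ \sum_i `|dx i ord0 * dz i ord0| <= dir_const * N ^+ 2 * mu,
      norm2 dx <= dir_const * N & norm2 dy <= dir_const * N].
Proof.
move=> hnb xzE hmu hzeta hlam hsig hnewt hres.
have [hx hz hxz hyl] := neighborhood_le hnb xzE hmu hzeta hlam.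
have hcompl := fun i => newton_complementarity i hnewt (let: And3 h _ _ := hres in h).
have [u [v [w [eP eD hu hw hv]]]] := newton_shift hnb hmu hsig hnewt hres.
have [x_gt0 z_gt0 hg _] := hnb.
have [_ _ _ _ /andP[gm0 _]] := hp.
have /andP[mu_gt0 mu_le] := hmu; have /andP[sg0 sg1] := hsig.
have := scaled_step_sum_le n_gt0 gm0 mu_gt0 hsig x_gt0 z_gt0 hg xzE hx hz hu hw hcompl.
rewrite -/energy_const => -[hT hsum].
have hu2 : norm2 u <= shift_const * rho ^+ 2 * N.
  apply: norm2_le_entries => i; apply: le_trans (hu i) _.
  by rewrite ler_pM2l // shift_const_gt0.
have scale_le k (q : 'cV[R]_k) : norm2 ((1 - sigma) *: q) <= norm2 q.
  by rewrite norm2Z ger0_norm ?subr_ge0 // ler_piMl ?norm2_ge0 //; lra.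
have ysN : 0 <= yshift_const * N by rewrite mulr_ge0 // ltW // yshift_const_gt0.
have scN : 0 <= shift_const * rho ^+ 2.
  by rewrite mulr_ge0 ?sqr_ge0 // ltW // shift_const_gt0.
have scNN : 0 <= shift_const * rho ^+ 2 * N by rewrite mulr_ge0.
have ecN : 0 <= energy_const * N by rewrite mulr_ge0 // ltW // energy_const_gt0.
have hgp : norm2 ((1 - sigma) *: (y - lam) - v) <= force_const * N.
  apply: le_trans (norm2B _ _) _; have := scale_le _ (y - lam).
  by rewrite /force_const; lra.
have hgd : norm2 (- ((1 - sigma) *: (x - zeta)) + u) <= force_const * N.
  apply: le_trans (norm2D _ _) _; have := scale_le _ (x - zeta).
  by rewrite norm2N /force_const; lra.
have low := prox_energy_ge mu_gt0 eP eD hgp hgd.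
rewrite exprMn in low.
have d0 := dotv_ge0 (dx - u); have e0 := dotv_ge0 (dy - v).
have de0 : 0 <= mu * (dotv (dx - u) (dx - u) + dotv (dy - v) (dy - v)).
  by rewrite mulr_ge0 ?(ltW mu_gt0) // addr_ge0.
(* The lower and the upper bound on 2 d.f both carry the factor mu, which cancels. *)
have hde : dotv (dx - u) (dx - u) + dotv (dy - v) (dy - v)
    <= (energy_const + 2 * force_const ^+ 2) * N ^+ 2.
  by rewrite -(ler_pM2l mu_gt0); lra.
have fc0 := sqr_ge0 force_const; have ec0 := energy_const_gt0.
have ys0 := yshift_const_gt0.
have hd k (q : 'cV[R]_k) : dotv q q <= (energy_const + 2 * force_const ^+ 2) * N ^+ 2 ->
    norm2 q <= (1 + (energy_const + 2 * force_const ^+ 2)) * N.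
  have : 0 <= energy_const + 2 * force_const ^+ 2 by lra.
  move: (energy_const + 2 * force_const ^+ 2) => a a0 hq.
  apply: norm2_le; first by rewrite mulr_ge0 // addr_ge0.
  apply: le_trans hq _; rewrite exprMn ler_wpM2r ?sqr_ge0 //.
  by have := sqr_ge0 a; rewrite !expr2; lra.
have ddx : norm2 (dx - u) <= (1 + (energy_const + 2 * force_const ^+ 2)) * N.
  by apply: hd; lra.
have ddy : norm2 (dy - v) <= (1 + (energy_const + 2 * force_const ^+ 2)) * N.
  by apply: hd; lra.
split.
- apply: (@le_trans _ _ ((2 * energy_const + 2 * force_const ^+ 2) * N ^+ 2 * mu)).
    by lra.
  rewrite ler_pM2r // ler_wpM2r ?sqr_ge0 // /dir_const.
  by lra.
- have := norm2D (dx - u) u; rewrite subrK /dir_const.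
  by lra.
- have := norm2D (dy - v) v; rewrite subrK /dir_const.
  by lra.
Qed.

(** * Admissible step lengths *)

(** The factor 2 is there because the primal and the dual part of the second-order residual are each
    bounded by half of it. *)
Definition growth_const : R :=
  2 * (dir_const * (iter_const + (bbar_const + cbar_const) / rho ^+ 2 + dir_const + 1)).
Definition seminorm_const : R := 1 + (1 + CQ) / Cmin.
(** In order: alpha < 1, the conditions on products, the 2-norm condition, the semi-norm condition.
    The allowed residual shrinks at most by 1 - alpha (1 - sigma_min / 2), the residual itself by 1
    - alpha; of the spare alpha sigma_min / 2, half goes to the Newton residuals and half to the
    terms in alpha^2, whence sigma_min / 4. *)
Definition step_const : R :=
  Num.min 2^-1 (Num.min (sigma_min p * (1 - gamma_mu p) / 2 / dir_const)
    (Num.min (C_N p * sigma_min p / (4 * rho ^+ 2) / growth_const)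
      (gamma_A p * rho * sigma_min p / (4 * rho ^+ 2)
        / (seminorm_const * growth_const)))).

Lemma dir_const_ge1 : 1 <= dir_const.
Proof.
have h1 := energy_const_gt0; have h2 := yshift_const_gt0.
have h3 : 0 <= shift_const * rho ^+ 2.
  by rewrite mulr_ge0 ?sqr_ge0 // ltW // shift_const_gt0.
by have := sqr_ge0 force_const; rewrite /dir_const; lra.
Qed.

Lemma dir_const_gt0 : 0 < dir_const.
Proof. exact: lt_le_trans ltr01 dir_const_ge1. Qed.

Lemma growth_const_gt0 : 0 < growth_const.
Proof.
have h1 := dir_const_gt0; have h2 := iter_const_gt0.
have h3 : 0 < (bbar_const + cbar_const) / rho ^+ 2.
  by rewrite divr_gt0 ?exprn_gt0 // addr_gt0 ?bbar_const_gt0 ?cbar_const_gt0.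
by rewrite mulr_gt0 // mulr_gt0 //; lra.
Qed.

Lemma seminorm_const_gt0 : 0 < seminorm_const.
Proof.
by have := divr_gt0 (addr_gt0 ltr01 hCQ) hCmin; rewrite /seminorm_const; lra.
Qed.

Lemma step_const_gt0 : 0 < step_const.
Proof.
have [/andP[s0 _] _ c0 /andP[g0 _] /andP[_ m1]] := hp.
have r2 : 0 < 4 * rho ^+ 2 by rewrite mulr_gt0 // exprn_gt0.
rewrite /step_const !lt_min invr_gt0 ltr0n /=; apply/and3P; split.
- by rewrite divr_gt0 ?dir_const_gt0 // divr_gt0 // mulr_gt0 // subr_gt0.
- by rewrite divr_gt0 ?growth_const_gt0 // divr_gt0 // mulr_gt0.
- rewrite divr_gt0 //; first by rewrite divr_gt0 // mulr_gt0 // mulr_gt0.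
  by rewrite mulr_gt0 ?growth_const_gt0 ?seminorm_const_gt0.
Qed.

Lemma step_constP : [/\ step_const <= 2^-1,
  step_const * dir_const <= sigma_min p * (1 - gamma_mu p) / 2,
  step_const * growth_const <= C_N p * sigma_min p / (4 * rho ^+ 2)
  & step_const * (seminorm_const * growth_const)
      <= gamma_A p * rho * sigma_min p / (4 * rho ^+ 2)].
Proof.
have h := lexx step_const; rewrite {2}/step_const !le_min in h.
case/and4P: h => h1 h2 h3 h4; split=> //.
- by rewrite -ler_pdivlMr ?dir_const_gt0.
- by rewrite -ler_pdivlMr ?growth_const_gt0.
- by rewrite -ler_pdivlMr // mulr_gt0 ?growth_const_gt0 ?seminorm_const_gt0.
Qed.

Lemma dotv_step (x z dx dz : 'cV[R]_n) mu sigma alpha :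
  dotv x z = N * mu ->
  (forall i, z i ord0 * dx i ord0 + x i ord0 * dz i ord0
     = - (x i ord0 * z i ord0) + sigma * mu) ->
  dotv (x + alpha *: dx) (z + alpha *: dz)
    = (1 - alpha * (1 - sigma)) * (N * mu) + alpha ^+ 2 * dotv dx dz.
Proof.
move=> hxz h.
have e : dotv dx z + dotv x dz = - (N * mu) + N * (sigma * mu).
  rewrite -hxz !dotvE -big_split /= mulr_natl -[in X in _ = _ + X](card_ord n).
  rewrite -sumr_const -sumrN -big_split /=; apply: eq_bigr => i _.
  by rewrite -h mulrC.
have -> : dotv (x + alpha *: dx) (z + alpha *: dz)
    = dotv x z + alpha * (dotv dx z + dotv x dz) + alpha ^+ 2 * dotv dx dz.
  by rewrite !dotv_bilin; ring.
by rewrite e hxz; ring.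
Qed.

(** Each second-order term is at most alpha sigma_min (1 - gamma_mu) mu / 2. The second inequality
    has slack alpha sigma (1 - gamma_mu) mu and must absorb two such terms, which explains the 1/2;
    the other two have more room. *)
Lemma step_products (x z dx dz : 'cV[R]_n) mu sigma alpha :
  0 < mu -> dotv x z = N * mu ->
  (forall i, gamma_mu p * mu <= x i ord0 * z i ord0) ->
  (forall i, z i ord0 * dx i ord0 + x i ord0 * dz i ord0
     = - (x i ord0 * z i ord0) + sigma * mu) ->
  sigma_min p <= sigma <= sigma_max p ->
  \sum_i `|dx i ord0 * dz i ord0| <= dir_const * N ^+ 2 * mu ->
  0 <= alpha <= step_const / N ^+ 4 ->
  let X := dotv (x + alpha *: dx) (z + alpha *: dz) in
  [/\ (1 - alpha * (1 - sigma_min p / 2)) * dotv x z <= X,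
      forall i, gamma_mu p / N * X
        <= (x + alpha *: dx) i ord0 * (z + alpha *: dz) i ord0
    & X <= (1 - 100^-1 * alpha) * dotv x z].
Proof.
move=> mu0 hxz hg hN /andP[hs1 hs2] hsum /andP[a0 ha] X.
have [/andP[s0 _] s1 _ _ /andP[g0 g1]] := hp.
have [k1 k2 _ _] := step_constP; have N1 := N_ge1; have N0 : 0 < N by rewrite ltr0n.
have aN : alpha * N ^+ 4 <= step_const by rewrite -ler_pdivlMr // exprn_gt0.
have aN2 : alpha * N ^+ 2 <= step_const.
  by apply: le_trans aN; rewrite ler_wpM2l // ler_weXn2l.
pose S := \sum_i `|dx i ord0 * dz i ord0|.
have aS : alpha * S <= sigma_min p * (1 - gamma_mu p) / 2 * mu.
  apply: (@le_trans _ _ (alpha * N ^+ 2 * (dir_const * mu))).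
    by rewrite -mulrA ler_wpM2l // mulrCA mulrA.
  apply: (@le_trans _ _ (step_const * (dir_const * mu))).
    by rewrite ler_pM2r // mulr_gt0 // dir_const_gt0.
  by rewrite mulrA ler_pM2r.
have d_le (d : R) : `|d| <= S -> `|alpha ^+ 2 * d| <=
    alpha * (sigma_min p * (1 - gamma_mu p) / 2 * mu).
  move=> hd; rewrite expr2 -mulrA normrM ger0_norm // ler_wpM2l //.
  by rewrite normrM ger0_norm // (le_trans _ aS) // ler_wpM2l.
have i_le i : `|dx i ord0 * dz i ord0| <= S.
  by rewrite /S (bigD1 i) //= lerDl sumr_ge0.
have d2 : `|dotv dx dz| <= S by rewrite dotvE; apply: ler_norm_sum.
have {d2} := d_le _ d2; rewrite ler_norml => /andP[p1 p2].
have XE := dotv_step alpha hxz hN; rewrite -/X in XE.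
have mN : mu <= N * mu by rewrite ler_peMl // ltW.
have smu : sigma_min p * mu <= sigma * mu by rewrite ler_pM2r.
have smu2 : sigma_min p * mu <= 2^-1 * mu.
  by rewrite ler_pM2r //; lra.
have sm0 : 0 < sigma_min p * mu by rewrite mulr_gt0.
have gs0 : 0 <= gamma_mu p * (sigma_min p * mu) by rewrite mulr_ge0 // ltW.
move: XE p1 p2; move: (alpha ^+ 2 * dotv dx dz) => pt XE p1 p2.
have aNm : 0 <= alpha * (N * mu) by rewrite !mulr_ge0 // ltW.
split.
- rewrite XE hxz.
  have h1 : 0 <= alpha * (N * mu * (sigma - sigma_min p)).
    by rewrite !mulr_ge0 ?(ltW N0) ?(ltW mu0) // subr_ge0.
  have h2 : alpha * (sigma_min p * mu) <= alpha * (sigma_min p * (N * mu)).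
    by rewrite !ler_wpM2l // ltW.
  have h3 : 0 <= alpha * (gamma_mu p * (sigma_min p * mu)) by rewrite mulr_ge0.
  lra.
- move=> i.
  have := d_le _ (i_le i); rewrite ler_norml => /andP[q1 _].
  have -> : (x + alpha *: dx) i ord0 * (z + alpha *: dz) i ord0
    = (1 - alpha) * (x i ord0 * z i ord0) + alpha * (sigma * mu)
      + alpha ^+ 2 * (dx i ord0 * dz i ord0).
    have := hN i; rewrite !mxE => e.
    transitivity (x i ord0 * z i ord0 + alpha * (z i ord0 * dx i ord0 + x i ord0 * dz i ord0)
      + alpha ^+ 2 * (dx i ord0 * dz i ord0)); first by ring.
    by rewrite e; ring.
  have -> : gamma_mu p / N * X = gamma_mu p * ((1 - alpha) * mu)
      + gamma_mu p * (alpha * (sigma * mu)) + gamma_mu p / N * pt.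
    by rewrite XE; field; rewrite gt_eqF.
  have gN : 0 <= gamma_mu p / N <= 1.
    apply/andP; split; first by rewrite divr_ge0 // ltW.
    by rewrite ler_pdivrMr // mul1r (le_trans (ltW g1)).
  case/andP: gN => gN0 gN1.
  have h1 : gamma_mu p / N * pt <= alpha * (sigma_min p * (1 - gamma_mu p) / 2 * mu).
    apply: le_trans (ler_wpM2l gN0 p2) _; rewrite ler_piMl //.
    by rewrite !mulr_ge0 ?invr_ge0 ?subr_ge0 // ltW.
  have a1 : alpha <= 1.
    rewrite (le_trans _ (_ : step_const <= 1)) //; last by lra.
    by apply: le_trans aN; rewrite ler_peMr // exprn_ege1.
  have h2 : (1 - alpha) * (gamma_mu p * mu) <= (1 - alpha) * (x i ord0 * z i ord0).
    by rewrite ler_wpM2l // subr_ge0.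
  have h3 : alpha * (1 - gamma_mu p) * (sigma_min p * mu)
      <= alpha * (1 - gamma_mu p) * (sigma * mu).
    by rewrite ler_wpM2l // mulr_ge0 // subr_ge0 ltW.
  lra.
- rewrite XE hxz.
  have h1 : 0 <= alpha * (N * mu * (2^-1 - sigma)).
    by rewrite !mulr_ge0 ?(ltW N0) ?(ltW mu0) // subr_ge0; lra.
  have h2 : alpha * (sigma_min p * mu) <= alpha * (2^-1 * (N * mu)).
    by rewrite ler_wpM2l // (le_trans smu2) // ler_pM2l // invr_gt0.
  have h3 : 0 <= alpha * (gamma_mu p * (sigma_min p * mu)) by rewrite mulr_ge0.
  lra.
Qed.

(** If a + t d were not positive, the affine function would vanish at s = - a / d in [0, t], and so
    would the product. *)
Lemma pos_of_products (a d a' d' t : R) : 0 < a ->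
  (forall s, 0 <= s <= t -> (a + s * d) * (a' + s * d') != 0) -> 0 <= t ->
  0 < a + t * d.
Proof.
move=> a0 h t0; rewrite ltNge; apply/negP => ht.
have d0 : d < 0 by rewrite ltNge; apply/negP => d0; have := mulr_ge0 t0 d0; lra.
have s_in : 0 <= a / - d <= t.
  apply/andP; split; first by rewrite divr_ge0 ?(ltW a0) // oppr_ge0 ltW.
  by rewrite ler_pdivrMr ?oppr_gt0 //; lra.
have := h _ s_in.
have -> : a / - d * d = - a by rewrite invrN mulrN mulNr divfK // lt_eqF.
by rewrite subrr mul0r eqxx.
Qed.

(** Positive products are needed along the whole segment: at its end alone both factors could be
    negative. *)
Lemma step_pos (x z dx dz : 'cV[R]_n) alpha :
  posv x -> posv z -> 0 <= alpha ->
  (forall s, 0 <= s <= alpha ->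
    forall i, 0 < (x + s *: dx) i ord0 * (z + s *: dz) i ord0) ->
  posv (x + alpha *: dx) /\ posv (z + alpha *: dz).
Proof.
move=> x0' z0' a0 h; split=> i; rewrite !mxE.
- apply: (@pos_of_products _ _ (z i ord0) (dz i ord0)) => // s hs.
  by have := h s hs i; rewrite !mxE => /gt_eqF ->.
- apply: (@pos_of_products _ _ (x i ord0) (dx i ord0)) => // s hs.
  by have := h s hs i; rewrite !mxE mulrC => /gt_eqF ->.
Qed.

Local Notation prim_res mu lam x y :=
  (A *m x + mu *: (y - lam) - b - (mu / @mu0 R n rho) *: bbar).
Local Notation dual_res mu zeta x y z :=
  (- (Q *m x) + A^T *m y + z - mu *: (x - zeta) - c - (mu / @mu0 R n rho) *: cbar).

(** Together with the converse below, this replaces the existential pair (bt, ct) by explicit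
    residuals divided by mu / mu0, which can be followed along a step. *)
Lemma neighborhood_residual mu zeta lam x y z : 0 < mu ->
  neighborhood P p rho y0 mu zeta lam x y z ->
  norm2 (col_mx (prim_res mu lam x y) (dual_res mu zeta x y z))
    <= C_N p * (mu / @mu0 R n rho) /\
  seminormA P (prim_res mu lam x y) (dual_res mu zeta x y z)
    <= gamma_A p * rho * (mu / @mu0 R n rho).
Proof.
move=> mu_gt0 [_ _ _ [bt [ct [-> -> hN hS]]]].
have t0 : 0 < mu / @mu0 R n rho by rewrite mu0E divr_gt0 // exprn_gt0.
move: (mu / _) t0 => t t0.
have -> : b + t *: (bbar + bt) - b - t *: bbar = t *: bt by vring.
have -> : c + t *: (cbar + ct) - c - t *: cbar = t *: ct by vring.
split; first by rewrite -scale_col_mx norm2Z gtr0_norm // mulrC ler_wpM2r // ltW.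
apply: le_trans (seminormAZ rankA _ _ (ltW t0)) _.
by rewrite mulrC ler_wpM2r // ltW.
Qed.

Lemma neighborhood_of_residual mu zeta lam x y z : 0 < mu ->
  posv x -> posv z -> (forall i, gamma_mu p * mu <= x i ord0 * z i ord0) ->
  norm2 (col_mx (prim_res mu lam x y) (dual_res mu zeta x y z))
    <= C_N p * (mu / @mu0 R n rho) ->
  seminormA P (prim_res mu lam x y) (dual_res mu zeta x y z)
    <= gamma_A p * rho * (mu / @mu0 R n rho) ->
  neighborhood P p rho y0 mu zeta lam x y z.
Proof.
move=> mu_gt0 x_gt0 z_gt0 hg hN hS; split=> //.
have t0 : 0 < mu / @mu0 R n rho by rewrite mu0E divr_gt0 // exprn_gt0.
move: (mu / _) t0 hN hS => t t0 hN hS.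
have ti0 : 0 < t^-1 by rewrite invr_gt0.
set rp := _ - t *: bbar in hN hS; set rd := _ - t *: cbar in hN hS.
exists (t^-1 *: rp), (t^-1 *: rd); split.
- by rewrite (scalerDr t) scalerA divff ?gt_eqF // scale1r /rp; vring.
- by rewrite (scalerDr t) scalerA divff ?gt_eqF // scale1r /rd; vring.
- by rewrite -scale_col_mx norm2Z gtr0_norm // mulrC ler_pdivrMr.
- apply: le_trans (seminormAZ rankA _ _ (ltW ti0)) _.
  by rewrite mulrC ler_pdivrMr.
Qed.

(** When the test succeeds, the proximal terms for the new estimates vanish, and the test is exactly
    what the neighborhood requires. *)
Lemma neighborhood_estimate_update zeta lam x y z :
  let mu := duality_measure x z in
  let est := estimate_update P p rho y0 x y z zeta lam in
  0 < mu -> neighborhood P p rho y0 mu zeta lam x y z ->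
  neighborhood P p rho y0 mu est.1 est.2 x y z.
Proof.
move=> mu est mu_gt0 hnb; rewrite /est /estimate_update.
case: ifP => // /andP[hN hS]; have [x_gt0 z_gt0 hg _] := hnb.
by apply: neighborhood_of_residual; rewrite //= !subrr !scaler0 ?addr0 ?subr0.
Qed.

Lemma neighborhood_start :
  neighborhood P p rho y0 (@mu0 R n rho) x0 y0 x0 y0 z0.
Proof.
have [_ _ c0 /andP[g0 _] /andP[gm0 gm1]] := hp.
have r2 : 0 < rho ^+ 2 by rewrite exprn_gt0.
split=> [i|i|i|]; rewrite ?mxE ?mulr1 //.
  by rewrite mu0E -expr2 ler_piMl // ltW.
exists 0, 0; rewrite divff ?mu0E ?gt_eqF // !scale1r !subrr !scaler0 !addr0 subr0.
split.
- by rewrite /Defs.bbar; vring.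
- by rewrite /Defs.cbar; vring.
- by rewrite col_mx0 norm2_0 ltW.
- apply: (le_trans (@seminormA_le _ _ _ P 0 0 0 0 0 _ _)).
  + by rewrite mulmx0.
  + by rewrite !mulmx0 oppr0 !addr0.
  + by rewrite col_mx0 norm2_0 mulr_ge0 // ltW.
Qed.

(** The first argument of [prim_res] is the new duality measure when q = dx.dz / n. Apart from
    Newton's equation the only terms are of second order: products of the change in mu with dy, and
    the contribution of q. *)
Lemma step_prim_res mu sigma q alpha zeta lam x y z dx dy dz rp rd rmu :
  newton_system P rho y0 mu sigma zeta lam x y z dx dy dz rp rd rmu ->
  prim_res ((1 - alpha * (1 - sigma)) * mu + alpha ^+ 2 * q) lam
      (x + alpha *: dx) (y + alpha *: dy)
  = (1 - alpha) *: prim_res mu lam x y + alpha *: rp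
    + alpha ^+ 2 *: (q *: (y - lam) - (q / @mu0 R n rho) *: bbar
        + (alpha * q - (1 - sigma) * mu) *: dy).
Proof.
move=> [_ n2 _]; move: n2; move: (@mu0 R n rho) => r n2.
transitivity ((1 - alpha) *: (A *m x + mu *: (y - lam) - b - (mu / r) *: bbar)
    + alpha *: rp
    + alpha ^+ 2 *: (q *: (y - lam) - (q / r) *: bbar
        + (alpha * q - (1 - sigma) * mu) *: dy)
    + alpha *: (A *m dx + mu *: dy - (- (A *m x + (sigma * mu) *: (y - lam)
             - (b + (sigma * mu / r) *: bbar)) + rp))).
  by move: (bbar) => bb; vring.
by rewrite n2 subrr scaler0 addr0.
Qed.

Lemma step_dual_res mu sigma q alpha zeta lam x y z dx dy dz rp rd rmu :
  newton_system P rho y0 mu sigma zeta lam x y z dx dy dz rp rd rmu ->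
  dual_res ((1 - alpha * (1 - sigma)) * mu + alpha ^+ 2 * q) zeta
      (x + alpha *: dx) (y + alpha *: dy) (z + alpha *: dz)
  = (1 - alpha) *: dual_res mu zeta x y z + alpha *: rd
    + alpha ^+ 2 *: (- (q *: (x - zeta)) - (q / @mu0 R n rho) *: cbar
        - (alpha * q - (1 - sigma) * mu) *: dx).
Proof.
move=> [n1 _ _]; move: n1; move: (@mu0 R n rho) => r n1.
transitivity ((1 - alpha) *: (- (Q *m x) + A^T *m y + z - mu *: (x - zeta) - c - (mu / r) *: cbar)
    + alpha *: rd
    + alpha ^+ 2 *: (- (q *: (x - zeta)) - (q / r) *: cbar
        - (alpha * q - (1 - sigma) * mu) *: dx)
    + alpha *: (- ((Q + mu%:M) *m dx) + A^T *m dy + dz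
      - (- (- (c + (sigma * mu / r) *: cbar) - Q *m x + A^T *m y + z
             - (sigma * mu) *: (x - zeta)) + rd))).
  by move: (cbar) => cb; rewrite mulmxDl mul_scalar_mx; vring.
by rewrite n1 subrr scaler0 addr0.
Qed.

(** The n^3 is |q| = O(n^2 mu) times vectors of norm O(n); the term mu d is absorbed through mu <=
    n^2 mu. *)
Lemma growth_le k (v w d : 'cV[R]_k) mu q alpha sigma :
  0 < mu -> 0 <= alpha <= 1 -> 0 <= sigma <= 1 ->
  `|q| <= dir_const * N ^+ 2 * mu ->
  norm2 v <= iter_const * N -> norm2 w <= (bbar_const + cbar_const) * N ->
  norm2 d <= dir_const * N ->
  norm2 (q *: v - (q / @mu0 R n rho) *: w + (alpha * q - (1 - sigma) * mu) *: d)
    <= growth_const / 2 * N ^+ 3 * mu.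
Proof.
move=> mu_gt0 /andP[a0 a1] /andP[s0 s1] hq hv hw hd; rewrite mu0E.
have r2 : 0 < rho ^+ 2 by rewrite exprn_gt0.
have N1 := N_ge1; have D0 := dir_const_gt0.
set S := dir_const * N ^+ 2 * mu in hq *.
have mu_le : mu <= N ^+ 2 * mu by rewrite ler_peMl ?(ltW mu_gt0) // exprn_ege1.
have S0 : 0 <= S by apply: le_trans hq.
have hb : 0 <= bbar_const + cbar_const.
  by rewrite addr_ge0 // ltW // ?bbar_const_gt0 ?cbar_const_gt0.
have k1 : norm2 (q *: v) <= S * (iter_const * N).
  by rewrite norm2Z; apply: ler_pM => //; apply: norm2_ge0.
have k2 : norm2 ((q / rho ^+ 2) *: w) <= S / rho ^+ 2 * ((bbar_const + cbar_const) * N).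
  rewrite norm2Z normrM (gtr0_norm (_ : 0 < (rho ^+ 2)^-1)) ?invr_gt0 //.
  apply: ler_pM; rewrite ?norm2_ge0 //; first by rewrite mulr_ge0 // invr_ge0 ltW.
  by rewrite ler_wpM2r // invr_ge0 ltW.
have k3 : norm2 ((alpha * q - (1 - sigma) * mu) *: d)
    <= (S + N ^+ 2 * mu) * (dir_const * N).
  rewrite norm2Z; apply: ler_pM; rewrite ?norm2_ge0 //.
  apply: le_trans (ler_normB _ _) _; apply: lerD.
    by rewrite normrM ger0_norm // (le_trans _ hq) // ler_piMl.
  rewrite ger0_norm; last by rewrite mulr_ge0 ?(ltW mu_gt0) // subr_ge0.
  by apply: le_trans mu_le; rewrite ler_piMl ?(ltW mu_gt0) //; lra.
apply: le_trans (norm2D _ _) _.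
apply: (@le_trans _ _ (S * (iter_const * N) + S / rho ^+ 2 * ((bbar_const + cbar_const) * N)
    + (S + N ^+ 2 * mu) * (dir_const * N))).
  by apply: lerD => //; apply: le_trans (norm2B _ _) _; apply: lerD.
rewrite le_eqVlt; apply/orP; left; apply/eqP; rewrite /S /growth_const.
by field; rewrite gt_eqF.
Qed.

Lemma step_neighborhood mu sigma zeta lam x y z dx dy dz rp rd rmu alpha :
  neighborhood P p rho y0 mu zeta lam x y z -> dotv x z = N * mu ->
  0 < mu <= rho ^+ 2 ->
  norm2 zeta <= est_const * N -> norm2 lam <= est_const * N ->
  sigma_min p <= sigma <= sigma_max p ->
  newton_system P rho y0 mu sigma zeta lam x y z dx dy dz rp rd rmu ->
  residual_condition P p rho mu rp rd rmu ->
  0 < alpha <= step_const / N ^+ 4 ->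
  neighborhood P p rho y0
    (duality_measure (x + alpha *: dx) (z + alpha *: dz)) zeta lam
    (x + alpha *: dx) (y + alpha *: dy) (z + alpha *: dz).
Proof.
move=> hnb xzE hmu hzeta hlam hs hnewt hres /andP[a0 ha].
have [/andP[s0 s1] s2 c0 /andP[g0 g1] /andP[gm0 gm1]] := hp.
have hsig : 0 <= sigma <= 1 by case/andP: hs => ? ?; apply/andP; split; lra.
have [hsum hdx hdy] := newton_le hnb xzE hmu hzeta hlam hsig hnewt hres.
have [_ _ hxz hyl] := neighborhood_le hnb xzE hmu hzeta hlam.
have hcompl := fun i => newton_complementarity i hnewt (let: And3 h _ _ := hres in h).
have [x_gt0 z_gt0 hg _] := hnb.
have /andP[mu_gt0 mu_le] := hmu.
have N0 : 0 < N by rewrite ltr0n.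
have N1 := N_ge1; have r2 : 0 < rho ^+ 2 by rewrite exprn_gt0.
have prods (s : R) (hs' : 0 <= s <= alpha) := step_products mu_gt0 xzE hg hcompl hs hsum
  (let: conj h1 h2 := andP hs' in introT andP (conj h1 (le_trans h2 ha))).
have [k0 _ k3 k4] := step_constP.
have aN : alpha * N ^+ 4 <= step_const by rewrite -ler_pdivlMr // exprn_gt0.
have aN3 : alpha * N ^+ 3 <= step_const.
  by apply: le_trans aN; rewrite ler_pM2l // ler_weXn2l.
have a1 : alpha <= 1.
  apply: (@le_trans _ _ step_const); last by lra.
  by apply: le_trans aN; rewrite ler_peMr ?(ltW a0) // exprn_ege1.
have X_gt0 (s : R) : 0 <= s <= alpha -> 0 < dotv (x + s *: dx) (z + s *: dz).
  move=> hs'; have [h _ _] := prods s hs'; apply: lt_le_trans h.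
  case/andP: hs' => s0' sa; rewrite xzE mulr_gt0 ?mulr_gt0 // subr_gt0.
  have : s * (1 - sigma_min p / 2) <= 1 * (1 - sigma_min p / 2).
    by rewrite ler_wpM2r //; lra.
  lra.
have a_in : 0 <= alpha <= alpha by rewrite (ltW a0) lexx.
have [xp zp] : posv (x + alpha *: dx) /\ posv (z + alpha *: dz).
  apply: step_pos => // [|s hs' i]; first exact: ltW.
  have [_ h _] := prods s hs'; apply: lt_le_trans (h i).
  by rewrite mulr_gt0 ?X_gt0 // divr_gt0.
have [hlow hprod _] := prods alpha a_in.
have X0 := X_gt0 alpha a_in.
set mu' := duality_measure _ _.
have mu'0 : 0 < mu' by rewrite divr_gt0.
pose q := dotv dx dz / N.
have muE : mu' = (1 - alpha * (1 - sigma)) * mu + alpha ^+ 2 * q.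
  rewrite /mu' /duality_measure (dotv_step _ xzE hcompl) /q.
  by field; rewrite gt_eqF.
have mu'_ge : (1 - alpha * (1 - sigma_min p / 2)) * mu <= mu'.
  by rewrite /mu' /duality_measure ler_pdivlMr // -mulrA (mulrC mu) -xzE.
have hq : `|q| <= dir_const * N ^+ 2 * mu.
  rewrite normrM normfV (gtr0_norm N0) ler_pdivrMr //.
  apply: le_trans (_ : dir_const * N ^+ 2 * mu <= _).
    by apply: le_trans hsum; rewrite dotvE; apply: ler_norm_sum.
  by rewrite ler_peMr // (le_trans _ hsum) // sumr_ge0.
have hcb : 0 < cbar_const * N by rewrite mulr_gt0 // cbar_const_gt0.
have hbb : 0 < bbar_const * N by rewrite mulr_gt0 // bbar_const_gt0.
have a01 : 0 <= alpha <= 1 by rewrite (ltW a0).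
have hwP : norm2 bbar <= (bbar_const + cbar_const) * N by have := bbar_le; lra.
have hwD : norm2 (- cbar) <= (bbar_const + cbar_const) * N.
  by rewrite norm2N; have := cbar_le; lra.
have gP := growth_le mu_gt0 a01 hsig hq hyl hwP hdy.
have gD := growth_le mu_gt0 a01 hsig hq hxz hwD hdx.
set vP := (q *: _ - _ + _) in gP.
(* The bound [gD] was taken with - cbar, so that its vector is - vD. *)
pose vD := - (q *: (x - zeta)) - (q / @mu0 R n rho) *: cbar
        - (alpha * q - (1 - sigma) * mu) *: dx.
have {}gD : norm2 vD <= growth_const / 2 * N ^+ 3 * mu.
  by apply: le_trans gD; rewrite -norm2N /vD le_eqVlt; apply/orP; left; apply/eqP;
     congr norm2; move: (cbar) => cb; vring.
have gPD : norm2 (col_mx vP vD) <= growth_const * N ^+ 3 * mu.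
  by apply: le_trans (norm2_col_mx _ _) _; lra.
have [rN rS] := neighborhood_residual mu_gt0 hnb.
have [_ eN eS] := hres.
have resP := step_prim_res q alpha hnewt; have resD := step_dual_res q alpha hnewt.
rewrite -muE -/vP in resP; rewrite -muE -/vD in resD.
(* The left side is exactly C (1 - alpha (1 - sigma_min / 2)) mu / rho^2. *)
have mono C : 0 < C ->
    (1 - alpha) * (C * (mu / rho ^+ 2)) + alpha * (sigma_min p / (4 * rho ^+ 2) * C * mu)
      + alpha * (C * sigma_min p / (4 * rho ^+ 2) * mu) <= C * (mu' / rho ^+ 2).
  move=> C0; rewrite [leRHS]mulrA ler_pdivlMr //.
  apply: le_trans (ler_wpM2l (ltW C0) mu'_ge).
  by rewrite le_eqVlt; apply/orP; left; apply/eqP; field; rewrite gt_eqF.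
have grow K : 0 <= K -> alpha ^+ 2 * (K * (growth_const * N ^+ 3 * mu))
    <= alpha * (step_const * (K * growth_const) * mu).
  move=> K0; have -> : alpha ^+ 2 * (K * (growth_const * N ^+ 3 * mu))
      = alpha * (alpha * N ^+ 3 * (K * growth_const) * mu) by ring.
  by rewrite ler_pM2l // ler_pM2r // ler_wpM2r // mulr_ge0 // ltW // growth_const_gt0.
have nonneg1a : 0 <= 1 - alpha by rewrite subr_ge0.
have sq0 : 0 <= alpha ^+ 2 := sqr_ge0 alpha.
refine (neighborhood_of_residual mu'0 xp zp _ _ _).
- move=> i; apply: le_trans (hprod i); by rewrite /mu' /duality_measure mulrAC mulrA.
- rewrite resP resD mu0E -!add_col_mx -!scale_col_mx.
  apply: le_trans (norm2D _ _) _; apply: le_trans (lerD (norm2D _ _) (lexx _)) _.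
  rewrite !norm2Z !ger0_norm ?(ltW a0) //.
  apply: le_trans (mono _ c0); rewrite mu0E in rN eN; apply: lerD; first apply: lerD.
  + exact: ler_wpM2l.
  + by rewrite ler_pM2l.
  + apply: le_trans (ler_wpM2l sq0 gPD) _.
    have := grow 1 ler01; rewrite !mul1r => h; apply: le_trans h _.
    by rewrite ler_pM2l // ler_pM2r.
- have gr0 : 0 < gamma_A p * rho by rewrite mulr_gt0.
  rewrite resP resD mu0E.
  apply: le_trans (seminormAD rankA _ _ _ _) _.
  apply: le_trans (lerD (seminormAD rankA _ _ _ _) (lexx _)) _.
  apply: le_trans (mono _ gr0); rewrite mu0E in rS eS; apply: lerD; first apply: lerD.
  + apply: le_trans (seminormAZ rankA _ _ nonneg1a) _; exact: ler_wpM2l.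
  + apply: le_trans (seminormAZ rankA _ _ (ltW a0)) _.
    by rewrite ler_pM2l // mulrA.
  + apply: le_trans (seminormAZ rankA _ _ sq0) _.
    have hK := seminormA_le_norm2 rankA vP vD hCmin A_sv (ltW hCQ) Q_le.
    have {}hK := le_trans hK (ler_wpM2l (ltW seminorm_const_gt0) gPD).
    apply: le_trans (ler_wpM2l sq0 hK) _.
    apply: le_trans (grow _ (ltW seminorm_const_gt0)) _.
    by rewrite ler_pM2l // ler_pM2r.
Qed.

(** * Runs of the algorithm *)

Lemma dotv_duality_measure (x z : 'cV[R]_n) : dotv x z = N * duality_measure x z.
Proof. by rewrite /duality_measure mulrC divfK // pnatr_eq0 -lt0n. Qed.

Lemma duality_measure_gt0 (x z : 'cV[R]_n) :
  posv x -> posv z -> 0 < duality_measure x z.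
Proof.
move=> x_gt0 z_gt0; rewrite divr_gt0 ?ltr0n // dotvE.
rewrite (bigD1 (Ordinal n_gt0)) //= ltr_wpDr ?mulr_gt0 //.
by apply: sumr_ge0 => i _; rewrite mulr_ge0 // ltW.
Qed.

Lemma estimate_update_le zeta lam x y z :
  let mu := duality_measure x z in
  let est := estimate_update P p rho y0 x y z zeta lam in
  0 < mu <= rho ^+ 2 -> neighborhood P p rho y0 mu zeta lam x y z ->
  norm2 zeta <= est_const * N -> norm2 lam <= est_const * N ->
  norm2 est.1 <= est_const * N /\ norm2 est.2 <= est_const * N.
Proof.
move=> mu est hmu hnb hz hl; have /andP[mu_gt0 _] := hmu.
have := neighborhood_estimate_update mu_gt0 hnb.
rewrite /est /estimate_update; case: ifP => // _ /= hnb'.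
exact: (neighborhood_refreshed_le hnb' (dotv_duality_measure x z) hmu).
Qed.

Context (T : trace R m n).
Context (run : ippmm_run P p rho y0 T) (res : residuals_controlled P p rho T).

(** The iterates move by the step of the line search, which itself gives membership for the old
    estimates; the update preserves it. The estimates are either kept or refreshed, so their bound
    does not grow. As mu decreases from rho^2, theta <= 1 throughout. *)
Lemma run_invariant k :
  [/\ neighborhood P p rho y0 (mus T k) (zetas T k) (lams T k) (xs T k) (ys T k) (zs T k),
      0 < mus T k <= rho ^+ 2,
      norm2 (zetas T k) <= est_const * N & norm2 (lams T k) <= est_const * N].
Proof.
have [[x0E y0E z0E zeta0E lam0E] it] := run.
elim: k => [|k [hnb hmu hz hl]].
  have mus0 : mus T 0%N = @mu0 R n rho by rewrite /mus x0E z0E.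
  rewrite mus0 x0E y0E z0E zeta0E lam0E; split.
  - exact: neighborhood_start.
  - by rewrite mu0E lexx exprn_gt0.
  - apply: le_trans x0_le _; rewrite ler_pM2r ?ltr0n // /est_const.
    by have := sum_const_gt0; have := y_const_gt0; slra.
  - apply: le_trans y0_le _; rewrite ler_pM2r ?ltr0n // /est_const.
    by have := sum_const_gt0; have := y_const_gt0; slra.
have [_ _ [[/andP[a0 a1] hdec hnb'] _] [xE yE zE] estE] := it k.
rewrite /trial_mu -xE -yE -zE -/(mus T k.+1) in hdec hnb'.
have [xp zp _ _] := hnb'.
have mu0' : 0 < mus T k.+1 := duality_measure_gt0 xp zp.
have mu1 : 0 < mus T k.+1 <= rho ^+ 2.
  have /andP[m0 m1] := hmu.
  rewrite mu0' (le_trans hdec) // (le_trans _ m1) // ler_piMl ?(ltW m0) //.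
  by rewrite lerBlDr lerDl mulr_ge0 ?invr_ge0 // ltW.
have [hz' hl'] := estimate_update_le mu1 hnb' hz hl.
have hnb2 := neighborhood_estimate_update mu0' hnb'.
by rewrite -estE /= in hz' hl' hnb2; split.
Qed.

Let alphabar : R := step_const / N ^+ 4.

Let alphabar_bounds : 0 < alphabar < 1.
Proof.
have [h _ _ _] := step_constP; have N1 := N_ge1.
have N4 : 1 <= N ^+ 4 by rewrite exprn_ege1.
rewrite divr_gt0 ?step_const_gt0 ?(lt_le_trans ltr01) //=.
by rewrite ltr_pdivrMr ?(lt_le_trans ltr01) // mul1r; lra.
Qed.

Lemma run_products k alpha : 0 <= alpha <= alphabar ->
  [/\ (1 - alpha * (1 - sigma_min p / 2)) * dotv (xs T k) (zs T k)
        <= dotv (trial_x T k alpha) (trial_z T k alpha),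
      forall i, gamma_mu p / N * dotv (trial_x T k alpha) (trial_z T k alpha)
        <= trial_x T k alpha i ord0 * trial_z T k alpha i ord0
    & dotv (trial_x T k alpha) (trial_z T k alpha)
        <= (1 - 100^-1 * alpha) * dotv (xs T k) (zs T k)].
Proof.
move=> ha; have [hnb hmu hz hl] := run_invariant k; have [_ it] := run.
have [hs hnewt _ _ _] := it k.
have [/andP[s0 s1] s2 _ _ _] := hp.
have hsig : 0 <= sigmas T k <= 1 by case/andP: hs => ? ?; apply/andP; split; lra.
have [hsum _ _] := newton_le hnb (dotv_duality_measure _ _) hmu hz hl hsig hnewt (res k).
have hc := fun i => newton_complementarity i hnewt (let: And3 h _ _ := res k in h).
have [_ _ hg _] := hnb; have /andP[mu_gt0 _] := hmu.
exact: step_products mu_gt0 (dotv_duality_measure _ _) hg hc hs hsum ha.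
Qed.

Lemma run_neighborhood k alpha : 0 < alpha <= alphabar ->
  neighborhood P p rho y0 (trial_mu T k alpha) (zetas T k) (lams T k)
    (trial_x T k alpha) (trial_y T k alpha) (trial_z T k alpha).
Proof.
move=> ha; have [hnb hmu hz hl] := run_invariant k; have [_ it] := run.
have [hs hnewt _ _ _] := it k.
exact: step_neighborhood hnb (dotv_duality_measure _ _) hmu hz hl hs hnewt (res k) ha.
Qed.

Lemma run_step_length : step_length_property P p rho y0 T step_const.
Proof.
exists alphabar; split=> [||k]; [exact: alphabar_bounds|exact: lexx|split].
  exact: run_products.
move=> _ alpha ha x' y' z' est; apply: neighborhood_estimate_update.
  by have [xp zp _ _] := run_neighborhood k ha; apply: duality_measure_gt0.
exact: run_neighborhood ha.
Qed.

(** [alphabar] passes both tests of the line search, so by maximality the chosen step is at least as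
    long, and a longer step only strengthens the decrease. *)
Lemma mus_decay k : mus T k <= (1 - 100^-1 * alphabar) ^+ k * mus T 0%N.
Proof.
have /andP[b0 b1] := alphabar_bounds.
elim: k => [|k IH]; first by rewrite mul1r.
have [_ it] := run; have [_ _ [[_ hdec _] hmax] [xE yE zE] _] := it k.
have [_ /andP[mu_gt0 _] _ _] := run_invariant k.
have hb : alphabar <= alphas T k.
  apply: hmax; split; first by rewrite b0 ltW.
    have [|_ _ h] := @run_products k alphabar; first by rewrite ltW //=.
    rewrite /trial_mu /duality_measure ler_pdivrMr ?ltr0n //.
    by rewrite -mulrA [_ * N]mulrC -dotv_duality_measure.
  by apply: run_neighborhood; rewrite b0 /=.
have -> : mus T k.+1 = trial_mu T k (alphas T k) by rewrite /mus xE zE.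
apply: le_trans hdec _; apply: (@le_trans _ _ ((1 - 100^-1 * alphabar) * mus T k)).
  by rewrite ler_pM2r //; lra.
by rewrite exprS -mulrA ler_wpM2l //; lra.
Qed.

End Bounds.

(** * From geometric decay to the iteration count *)

Section IterationCount.
Context {R : realType}.

(** As 1 - t <= exp(- t), k steps gain exp(- t k). In the threshold on t k, omega ln(1 / eps) + ln C
    compensates the initial measure and the remaining ln(1 / eps) reaches eps. *)
Lemma iteration_count_le (mu : nat -> R) n kappa C omega eps k :
  (0 < n)%N -> 0 < kappa <= 1 -> 0 < eps -> 0 < C ->
  (forall j, mu j <= (1 - 100^-1 * (kappa / n%:R ^+ 4)) ^+ j * mu 0%N) ->
  mu 0%N <= C / eps `^ omega ->
  iteration_count n kappa C omega eps <= k%:R -> mu k <= eps.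
Proof.
move=> n_gt0 /andP[k0 k1] e0 C0 hmu hmu0 hk.
have N1 : 1 <= n%:R ^+ 4 :> R by rewrite exprn_ege1 // ler1n.
have N0 : 0 < n%:R ^+ 4 :> R by apply: lt_le_trans N1.
pose t := 100^-1 * (kappa / n%:R ^+ 4).
have t0 : 0 < t by rewrite mulr_gt0 ?invr_gt0 // divr_gt0.
have t1 : 0 <= 1 - t.
  have : kappa / n%:R ^+ 4 <= 1 by rewrite ler_pdivrMr // mul1r (le_trans k1).
  by rewrite /t; lra.
have tk : (1 + omega) * ln (1 / eps) + ln C <= t * k%:R.
  apply: le_trans (ler_wpM2l (ltW t0) hk); rewrite le_eqVlt; apply/orP; left; apply/eqP.
  by rewrite /iteration_count /t; field; rewrite !gt_eqF // ltr0n.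
have hpow : (1 - t) ^+ k <= expR (- (t * k%:R)).
  rewrite -(mulNr t) expRM_natr lerXn2r ?nnegrE ?expR_ge0 //.
  exact: expR_ge1Dx.
apply: le_trans (hmu k) _; rewrite -/t.
apply: le_trans (ler_wpM2l (exprn_ge0 _ t1) hmu0) _.
apply: le_trans (ler_wpM2r _ hpow) _.
  by rewrite divr_ge0 ?powR_ge0 // ltW.
have -> : C / eps `^ omega = expR (ln C - omega * ln eps).
  by rewrite expRB lnK ?posrE // /powR gt_eqF.
rewrite -expRD -{2}[eps](lnK (_ : eps \in Num.pos)) ?posrE // ler_expR.
by move: tk; rewrite div1r lnV ?posrE //; lra.
Qed.

(** Near eps = 1 the factor ln(1 / eps) tends to 0 while ln C stays; eps <= eps0 < 1 allows |ln C|
    to be charged to ln(1 / eps). *)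
Lemma iteration_count_bigO (kappa C omega eps0 : R) :
  0 < kappa -> 0 < omega -> 0 < eps0 < 1 ->
  exists K : R, 0 < K /\ forall (n : nat) (eps : R), 0 < eps <= eps0 ->
    `|iteration_count n kappa C omega eps| <= K * (n%:R ^+ 4 * ln (1 / eps)).
Proof.
move=> k0 w0 /andP[e0 e1].
have l0 : 0 < ln (1 / eps0) by rewrite ln_gt0 // div1r invf_gt1.
exists (100 / kappa * (1 + omega + `|ln C| / ln (1 / eps0))); split.
  have := divr_ge0 (normr_ge0 (ln C)) (ltW l0) => h.
  by rewrite mulr_gt0 ?divr_gt0 //; lra.
move=> n eps /andP[ep0 ep1].
have l1 : ln (1 / eps0) <= ln (1 / eps).
  by rewrite !div1r ler_ln ?posrE ?invr_gt0 // lef_pV2 ?posrE //.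
have lp : 0 < ln (1 / eps) := lt_le_trans l0 l1.
have hC : `|ln C| <= `|ln C| / ln (1 / eps0) * ln (1 / eps).
  by rewrite -(mulrA `|ln C|) ler_peMr // ler_pdivlMl // mulr1.
have n4 : 0 <= n%:R ^+ 4 :> R by rewrite exprn_ge0.
have -> : 100 / kappa * (1 + omega + `|ln C| / ln (1 / eps0)) * (n%:R ^+ 4 * ln (1 / eps))
    = n%:R ^+ 4 / (100^-1 * kappa)
      * ((1 + omega) * ln (1 / eps) + `|ln C| / ln (1 / eps0) * ln (1 / eps)).
  by field; rewrite !gt_eqF.
have c0 : 0 <= n%:R ^+ 4 / (100^-1 * kappa) :> R.
  by rewrite divr_ge0 // mulr_ge0 ?invr_ge0 // ltW.
rewrite /iteration_count normrM (ger0_norm c0) ler_wpM2l //.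
apply: le_trans (ler_normD _ _) _; apply: lerD => //.
by rewrite ger0_norm // mulr_ge0 ?addr_ge0 // ltW.
Qed.

End IterationCount.

Theorem theorem3p1 (R : realType) (p : ippmm_params R) (rho : R)
    (Cy Cstar Cmin Cmax CQ Cr : R)
    (hp : valid_params p) (hrho : 0 < rho) (hCstar : 0 <= Cstar)
    (hCmin : 0 < Cmin) (hCmax : 0 < Cmax) (hCQ : 0 < CQ) (hCr : 0 < Cr) :
  exists kappa : R,
  [/\ 0 < kappa,
      forall (m n : nat) (P : qp R m n) (y0 : 'cV[R]_m) (T : trace R m n),
        (0 < n)%N ->
        is_diag_mx (qpQ P) -> psd (qpQ P) ->
        assumption_B P Cstar ->
        assumption_F P Cmin Cmax CQ Cr ->
        `|y0| <= Cy ->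
        ippmm_run P p rho y0 T ->
        residuals_controlled P p rho T ->
        step_length_property P p rho y0 T kappa /\
        (forall eps C omega : R,
          0 < eps < 1 -> 0 < C -> 0 < omega ->
          mus T 0%N <= C / eps `^ omega ->
          forall k : nat,
            iteration_count n kappa C omega eps <= k%:R -> mus T k <= eps)
    & forall C omega : R, 0 < C -> 0 < omega ->
        forall eps0 : R, 0 < eps0 < 1 ->
        exists K : R, 0 < K /\
          forall (n : nat) (eps : R), 0 < eps <= eps0 ->
            `|iteration_count n kappa C omega eps|
              <= K * (n%:R ^+ 4 * ln (1 / eps))].
Proof.
(* Cy may be negative when no y0 satisfies the bound. *)
have hCy : 0 <= `|Cy| by [].
(* Built from the parameters and the assumed bounds only, before dimensions and data are
   introduced. *)
pose kappa := step_const p rho `|Cy| Cstar Cmin Cmax CQ Cr.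
have k0 : 0 < kappa by exact: step_const_gt0.
have k1 : kappa <= 1.
  have [h _ _ _] := step_constP hp hrho hCy hCstar hCmin hCmax hCQ hCr.
  by apply: le_trans h _; rewrite invf_le1 // ler1n.
exists kappa; split=> // [m n P y0 T n0 Qd Qpsd hB hF hy run res|C omega _ w0 eps0 he]; last first.
  exact: iteration_count_bigO k0 w0 he.
have [rA sv_ge sv_le evQ hbc] := hF.
have [xo [yo [zo [xopt yopt [hxo hyo hzo]]]]] := hB.
have xz := complementarity Qpsd xopt yopt.
have [[Axo xo0] _] := xopt; have [[dyo zo0] _] := yopt.
(* Full row rank forces m <= n, so vectors of dimension m are bounded in terms of n as well. *)
have mn : m%:R <= n%:R :> R by rewrite ler_nat -rA rank_leq_col.
have AT_le := norm2_trmx_le rA (ltW hCmax) sv_le.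
have bound k (v : 'cV[R]_k) a : 0 <= a -> k%:R <= n%:R :> R ->
    (forall i, `|v i ord0| <= a) -> norm2 v <= a * n%:R.
  by move=> a0 kn h; apply: le_trans (norm2_le_entries h) _; rewrite ler_wpM2l.
have entry k (v : 'cV[R]_k) a : `|v| <= a -> forall i, `|v i ord0| <= a.
  by move=> h i; apply: le_trans h; apply: abs_le_mx_norm.
have feas : - (qpQ P *m xo) + (qpA P)^T *m yo + zo = qpc P.
  by rewrite -addrA dyo addKr.
have xo_in i : 0 <= xo i ord0 <= Cstar.
  by rewrite xo0 (le_trans (ler_norm _)) // entry.
have zo_in i : 0 <= zo i ord0 <= Cstar.
  by rewrite zo0 (le_trans (ler_norm _)) // entry.
have b_le : norm2 (qpb P) <= Cr * n%:R.
  by apply: bound (ltW hCr) mn _ => i; have := entry _ _ _ hbc (rshift n i); rewrite col_mxEd.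
have c_le : norm2 (qpc P) <= Cr * n%:R.
  apply: bound (ltW hCr) (lexx _) _ => i.
  by have := entry _ _ _ hbc (lshift m i); rewrite col_mxEu.
have y0_le : norm2 y0 <= `|Cy| * n%:R.
  by apply: bound mn _ => // i; apply: le_trans (ler_norm Cy); apply: entry.
have yo_le : norm2 yo <= Cstar * n%:R by apply: bound mn _ => //; apply: entry.
have A_ge := norm2_trmx_ge rA (ltW hCmin) sv_ge.
have A_le := norm2_mulmx_le (ltW hCmax) AT_le.
have Q_le := norm2_diag_le Qd Qpsd (ltW hCQ) evQ.
have Q_ge0 := Qpsd.2.
split; first by apply: run_step_length run res; eassumption.
move=> eps C omega /andP[e0 _] C0 _ hmu0 k.
apply: iteration_count_le => //; first by rewrite k0.
by apply: mus_decay run res; eassumption.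
Qed.
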